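(* Let $\mathcal{E}$ be a solvable evolution algebra with maximum index of solvability over a field $\mathbb{K}$ of characteristic different from $2$, $n=\dim\mathcal{E}$. Then $\mathcal{E}$ is modular if and only if both of the following hold: (a) the derived series of $\mathcal{E}$ does not have two consecutive terms that are not basic ideals; and (b) with respect to a natural basis $B=\{e_1,\dots,e_n\}$ of $\mathcal{E}$ in normal form (such a basis exists when (a) holds), there does not exist a subalgebra of $\mathcal{E}$ of the form $U=K+\mathrm{span}\{e_i-e_{i+1},\,e_j+\varepsilon e_{j+1}\}$, with $\varepsilon\in\{1,-1\}$, where $i<j$, $(i,i+1),(j,j+1)\in\Lambda$, $K$ is a subspace spanned by elements of $B$ different from $e_i,e_{i+1},e_j,e_{j+1}$, and such that $\pi_{i(i+1)}(e_j^2)\notin\mathrm{span}\{e_i-e_{i+1}\}$ or $\pi_{i(i+1)}(e_{j+1}^2)\notin\mathrm{span}\{e_i-e_{i+1}\}$.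
   Context: An evolution algebra over a field $\mathbb{K}$ is a finite-dimensional $\mathbb{K}$-algebra $\mathcal{E}$ (bilinear product, not necessarily associative) admitting a basis $B=\{e_1,\dots,e_n\}$, called a natural basis, with $e_ie_j=0$ for $i\neq j$; writing $e_i^2=\sum_k a_{ik}e_k$, the structure matrix is $M_B(\mathcal{E})=(a_{ik})$. Put $\mathcal{E}^{(1)}=\mathcal{E}$, $\mathcal{E}^{(k+1)}=\mathcal{E}^{(k)}\mathcal{E}^{(k)}$ (span of products). $\mathcal{E}$ is solvable if $\mathcal{E}^{(k)}=0$ for some $k$, the least such $k$ being its index of solvability; the series $0=\mathcal{E}^{(k)}\subsetneq\mathcal{E}^{(k-1)}\subsetneq\dots\subsetneq\mathcal{E}^{(2)}\subsetneq\mathcal{E}$ is the derived series. An $n$-dimensional solvable evolution algebra has maximum index of solvability if the index is $n+1$. An ideal $I$ is a basic ideal relative to a natural basis $B$ if $I$ is the span of a subset of $B$; ''basic ideal'' without mention of $B$ means basic relative to some natural basis. A natural basis $B=\{e_1,\dots,e_n\}$ is said here to be in normal form if $M_B(\mathcal{E})=(a_{ij})$ is block lower triangular of rank $n-1$ with each diagonal block equal to the $1\times 1$ block $0$ or the $2\times2$ block $\begin{pmatrix} 1 & 1 \\ -1 & -1 \end{pmatrix}$. (For $\mathcal{E}$ solvable with maximum index of solvability in characteristic $\neq2$, such a basis exists if and only if condition (a) holds.) Given such $B$, $\Lambda$ is the set of pairs $(i,i+1)$ with $\begin{pmatrix} a_{ii} & a_{i(i+1)} \\ {a}_{(i+1)i}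 & a_{(i+1)(i+1)} \end{pmatrix}=\begin{pmatrix} 1 & 1 \\ -1 & -1 \end{pmatrix}$, and for $i\neq j$, $\pi_{ij}:\mathcal{E}\to\mathrm{span}\{e_i,e_j\}$ is the linear projection sending $e_i\mapsto e_i$, $e_j\mapsto e_j$ and all other $e_k\mapsto 0$. $\langle S\rangle$ denotes the subalgebra generated by $S$. $\mathcal{E}$ is modular if $\langle U,V\cap W\rangle=\langle U,V\rangle\cap W$ for all subalgebras $U,V,W$ of $\mathcal{E}$ with $U\subseteq W$. *)

(* Defs.v *)
From HB Require Import structures.
From mathcomp Require Import all_boot all_order all_algebra.
From mathcomp Require Import sesquilinear.

Set Implicit Arguments.
Unset Strict Implicit.
Unset Printing Implicit Defensive.

Import GRing.Theory.
Local Open Scope ring_scope.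

Section EvolutionAlgebra.

Variables (K : fieldType) (E : vectType K).

(* The product of the algebra; it is neither associative nor unital, so a
   bilinear map is used rather than an algType structure. *)
Variable mul : {bilinear E -> E -> E}.

Definition natural_basis n (B : n.-tuple E) : Prop :=
  basis_of {:E} B /\
  forall i j : 'I_n, i != j -> mul (tnth B i) (tnth B j) = 0.

Definition evolution_algebra : Prop :=
  exists B : (\dim {:E}).-tuple E, natural_basis B.

(* Row i holds the coordinates of the square of the i-th basis vector. *)
Definition structure_matrix n (B : n.-tuple E) : 'M[K]_n :=
  \matrix_(i, k) coord B k (mul (tnth B i) (tnth B i)).

Definition mulv (U V : {vspace E}) : {vspace E} :=
  <<[seq mul u v | u <- vbasis U, v <- vbasis V]>>%VS.

(* Terms are numbered from 1: [derived 1] is the whole algebra (and so is the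
   unused [derived 0]). *)
Definition derived (k : nat) : {vspace E} :=
  iter k.-1 (fun U => mulv U U) {:E}%VS.

Definition solvable : Prop := exists k, (0 < k)%N /\ derived k = 0%VS.

Definition solvability_index (k : nat) : Prop :=
  [/\ (0 < k)%N, derived k = 0%VS
    & forall j, (0 < j < k)%N -> derived j <> 0%VS].

Definition max_solvability_index : Prop := solvability_index (\dim {:E}).+1.

Definition subalgebra (U : {vspace E}) : Prop :=
  forall x y, x \in U -> y \in U -> mul x y \in U.

Definition ideal (I : {vspace E}) : Prop :=
  forall x y, y \in I -> mul x y \in I /\ mul y x \in I.

Definition span_of n (B : n.-tuple E) (S : {set 'I_n}) : {vspace E} :=
  <<[seq tnth B k | k in S]>>%VS.

Definition basic_ideal_wrt n (B : n.-tuple E) (I : {vspace E}) : Prop :=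
  ideal I /\ exists S : {set 'I_n}, I = span_of B S.

Definition basic_ideal (I : {vspace E}) : Prop :=
  exists B : (\dim {:E}).-tuple E, natural_basis B /\ basic_ideal_wrt B I.

(* The series of an algebra of maximum index has the terms 1, ..., dim E + 1. *)
Definition no_two_consecutive_nonbasic : Prop :=
  ~ exists k, [/\ (1 <= k <= \dim {:E})%N,
                  ~ basic_ideal (derived k) & ~ basic_ideal (derived k.+1)].

(* The 2 x 2 block with rows (1, 1) and (-1, -1). *)
Definition nilblock : 'M[K]_2 := \matrix_(i, j) (-1) ^+ i.

Inductive normal_block : forall p, 'M[K]_p -> Prop :=
  | NormalBlock1 : normal_block (0 : 'M[K]_1)
  | NormalBlock2 : normal_block nilblock.

Definition normal_form_mx n (A : 'M[K]_n) : Prop :=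
  (exists (m : nat) (p : 'I_m -> nat) (eq_n : (\sum_(i < m) p i)%N = n)
      (D : forall i j : 'I_m, 'M[K]_(p i, p j)),
    [/\ A = castmx (eq_n, eq_n) (\mxblock_(i < m, j < m) D i j),
        forall i j : 'I_m, (i < j)%N -> D i j = 0
      & forall i : 'I_m, normal_block (D i i)])
  /\ \rank A = n.-1.

Definition normal_form n (B : n.-tuple E) : Prop :=
  natural_basis B /\ normal_form_mx (structure_matrix B).

Definition Lambda n (B : n.-tuple E) (i i' : 'I_n) : Prop :=
  let A := structure_matrix B in
  [/\ i' = i.+1 :> nat, A i i = 1, A i i' = 1, A i' i = -1 & A i' i' = -1].

Definition proj2 n (B : n.-tuple E) (i j : 'I_n) (x : E) : E :=
  coord B i x *: tnth B i + coord B j x *: tnth B j.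

Definition obstruction n (B : n.-tuple E) (U : {vspace E}) : Prop :=
  exists (i i' j j' : 'I_n) (eps : K) (S : {set 'I_n}),
    let e := tnth B in
    let L := <[e i - e i']>%VS in
    [/\ (i < j)%N, Lambda B i i' /\ Lambda B j j', eps = 1 \/ eps = -1,
        [disjoint S & [set i; i'; j; j']]
      & U = (span_of B S + <<[:: e i - e i'; (e j + eps *: e j')%R]>>)%VS
        /\ (proj2 B i i' (mul (e j) (e j)) \notin L \/
            proj2 B i i' (mul (e j') (e j')) \notin L)].

Definition no_obstruction n (B : n.-tuple E) : Prop :=
  ~ exists U : {vspace E}, subalgebra U /\ obstruction B U.

(* Membership in the subalgebra generated by S, that is, in the intersection
   of all the subalgebras containing S. *)
Definition in_gen (S : {pred E}) (x : E) : Prop :=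
  forall A : {vspace E}, subalgebra A -> {subset S <= A} -> x \in A.

(* The modular law <U, V :&: W> = <U, V> :&: W, as an equality of sets. *)
Definition modular : Prop :=
  forall U V W : {vspace E},
    subalgebra U -> subalgebra V -> subalgebra W -> (U <= W)%VS ->
    forall x : E,
      in_gen [predU U & (V :&: W)%VS] x <-> in_gen [predU U & V] x /\ x \in W.

End EvolutionAlgebra.

(* Main.v *)
(** Let [e] be a natural basis in normal form and replace each pair
    [e_i, e_{i+1}] coming from a 2 x 2 block by [f = e_i + e_{i+1}] and
    [g = e_i - e_{i+1}].  In the new basis [b] the derived series is the flag
    [F_d = <b_0, ..., b_{d-1}>], and squaring lowers the leading term of a vector
    by one step, or by two for [g].  Hence a subalgebra [U] whose smallest
    enclosing flag term is [F_d] is cut out of [F_d] by equations [x_f = 0], one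
    for each block whose [f]-coordinate vanishes on [U].  Without an obstruction,
    each of these equations alone already defines a subalgebra of [F_d]; then sums
    of subalgebras are subalgebras and the modular law is that of subspaces.
    Conversely, an obstruction, or two consecutive terms of the derived series
    that are not basic, produces vectors [x] and [v] with [x ^ 2 = v ^ 2] small but
    [x v] large, and the modular law fails for [U = R + <x>], [V = R + <v>] and a
    term [W] of the derived series containing [U].

    The normal form is built from the bottom of the derived series.  What makes
    this possible is that a term of the derived series spanned by part of one
    natural basis is spanned by part of any other, because the squares of the
    basis vectors satisfy a single linear relation. *)

Require Import Defs.
From HB Require Import structures.
From mathcomp Require Import all_boot all_order all_algebra.
From mathcomp Require Import sesquilinear.
From mathcomp Require Import zify ring.

Set Implicit Arguments.
Unset Strict Implicit.
Unset Printing Implicit Defensive.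

Import GRing.Theory.
Local Open Scope ring_scope.

(** * Coordinates and flags *)

(** Modulo lower vectors a block gives [e_i ^ 2 = f] and [e_{i+1} ^ 2 = - f]. Hence
    [f ^ 2 = g ^ 2 = e_i ^ 2 + e_{i+1} ^ 2] lies below the block, whereas
    [f g = e_i ^ 2 - e_{i+1} ^ 2] equals [2 f] modulo lower vectors. So the [f]-coordinates are the
    only ones that a subalgebra can miss: squaring a vector with leading term [g] and no
    [f]-coordinate jumps over [f], and in characteristic different from 2 the product [f g] lands on
    it. In the natural basis [x_f = 0] reads [x_i + x_{i+1} = 0], which is membership of the
    projection of [x] in the line of [e_i - e_{i+1}]. An obstruction thus says that one of
    [e_j ^ 2], [e_{j+1} ^ 2] violates the equation of the lower block [i]. Their sum satisfies it,
    because [U] is a subalgebra; what is left is that the product [f g] of the upper block [j]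
    violates it. The sign [eps] chooses which of [f] and [g] of block [j] lies in [U], and both have
    the same square. *)

Section Coordinates.

Variables (K : fieldType) (E : vectType K) (n : nat) (X : n.-tuple E).

(* Coordinates indexed by [nat]: indices [i >= n] give [0]. *)
Definition coordn (i : nat) (x : E) : K :=
  if insub i is Some j then coord X j x else 0.

Lemma coordn_is_scalar i : scalar (coordn i).
Proof.
by rewrite /coordn => a x y; case: insub => [j|]; rewrite ?linearP ?mulr0 ?addr0.
Qed.

HB.instance Definition _ i :=
  GRing.isLinear.Build K E K *%R (coordn i) (coordn_is_scalar i).

Lemma coordnD i x y : coordn i (x + y) = coordn i x + coordn i y.
Proof. exact: linearD. Qed.

Lemma coordnB i x y : coordn i (x - y) = coordn i x - coordn i y.
Proof. exact: linearB. Qed.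

Lemma coordnZ i a x : coordn i (a *: x) = a * coordn i x.
Proof. exact: linearZ. Qed.

Lemma coordn_ord (i : 'I_n) x : coordn i x = coord X i x.
Proof. by rewrite /coordn valK. Qed.

Lemma coordn_ge i x : (n <= i)%N -> coordn i x = 0.
Proof. by move=> le_n; rewrite /coordn insubN // -leqNgt. Qed.

Definition flag d : {vspace E} := <<take d X>>%VS.

Lemma flagS d1 d2 : (d1 <= d2)%N -> (flag d1 <= flag d2)%VS.
Proof.
by move=> le_d; apply: sub_span => x; rewrite -(take_takel X le_d) => /mem_take.
Qed.

Lemma dim_flag_leq d : (\dim (flag d) <= d)%N.
Proof. by apply: leq_trans (dim_span _) _; rewrite size_take_min geq_minl. Qed.

Lemma flag0 : flag 0 = 0%VS.
Proof. by rewrite /flag take0 span_nil. Qed.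

Hypothesis Xbasis : basis_of {:E} X.

Lemma coordn_nth i j : (j < n)%N -> coordn i X`_j = (i == j)%:R.
Proof.
move=> ltj; case: (ltnP i n) => [lti|lei].
  rewrite (coordn_ord (Ordinal lti)).
  by rewrite (coord_free (Ordinal ltj) _ (basis_free Xbasis)) eq_sym.
by rewrite coordn_ge // gtn_eqF // (leq_trans ltj).
Qed.

Lemma coordn_sum x : x = \sum_(i < n) coordn i x *: X`_i.
Proof.
rewrite {1}(coord_basis Xbasis (memvf x)).
by apply: eq_bigr => i _; rewrite coordn_ord.
Qed.

Lemma mem_flag d x :
  reflect (forall i, (d <= i)%N -> coordn i x = 0) (x \in flag d).
Proof.
apply: (iffP idP) => [xF i led | x0].
  rewrite [x](coord_span (X := in_tuple (take d X))) // linear_sum big1 // => j _.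
  rewrite linearZ /=; have := ltn_ord j.
  rewrite [X in (_ < X)%N]size_take_min size_tuple leq_min => /andP[ltjd ltjn].
  by rewrite nth_take // coordn_nth // gtn_eqF ?mulr0 // (leq_trans ltjd).
rewrite (coordn_sum x); apply: memv_suml => i _.
case: (ltnP i d) => [ltid|]; last by move=> /x0 ->; rewrite scale0r mem0v.
apply/memvZ/memv_span; rewrite -(nth_take 0 ltid) mem_nth //.
by rewrite size_take_min size_tuple leq_min ltid ltn_ord.
Qed.

Lemma flagf d : (n <= d)%N -> flag d = {:E}%VS.
Proof. by move=> led; rewrite /flag take_oversize ?size_tuple // (span_basis Xbasis). Qed.

Lemma nth_flag i d : (i < d)%N -> X`_i \in flag d.
Proof.
move=> ltid; case: (ltnP i n) => [ltin|len]; last first.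
  by rewrite nth_default ?size_tuple // mem0v.
by apply/mem_flag => j led; rewrite coordn_nth // gtn_eqF // (leq_trans ltid).
Qed.

Lemma flag_pred d x : x \in flag d.+1 -> coordn d x = 0 -> x \in flag d.
Proof.
move=> /mem_flag xF xd; apply/mem_flag => i; rewrite leq_eqVlt.
by case/predU1P => [<- //|]; apply: xF.
Qed.

Lemma flag_subl d x : x \in flag d.+1 -> x - coordn d x *: X`_d \in flag d.
Proof.
move=> xF; apply: flag_pred.
  by rewrite rpredB // rpredZ // nth_flag.
case: (ltnP d n) => [ltdn|led]; last by rewrite coordn_ge.
by rewrite linearB linearZ /= coordn_nth // eqxx mulr1 subrr.
Qed.

(** Testing a basis of [U] makes the condition boolean, so that it can index sums and case
    analyses. *)
Definition vanish (U : {vspace E}) i : bool :=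
  all (fun x => coordn i x == 0) (vbasis U).

Lemma vanishP (U : {vspace E}) i :
  reflect (forall x, x \in U -> coordn i x = 0) (vanish U i).
Proof.
apply: (iffP allP) => [U0 x xU | U0 x /vbasis_mem/U0 ->] //.
rewrite (coord_vbasis xU) linear_sum big1 // => j _.
by rewrite linearZ /= (eqP (U0 _ _)) ?mulr0 // mem_nth ?size_tuple.
Qed.

Lemma vanishPn (U : {vspace E}) i :
  reflect (exists2 x, x \in U & coordn i x != 0) (~~ vanish U i).
Proof.
apply: (iffP allPn) => [[x /vbasis_mem xU x0] | [x xU x0]]; first by exists x.
by apply/allPn/negP => /vanishP/(_ x xU)/eqP; rewrite (negPf x0).
Qed.

Lemma bilinear_mem (mul : {bilinear E -> E -> E}) (W : {vspace E}) x y :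
    (forall i j, (i < n)%N -> (j < n)%N -> coordn i x != 0 -> coordn j y != 0 ->
       mul X`_i X`_j \in W) ->
  mul x y \in W.
Proof.
move=> XW; rewrite (coordn_sum x) (coordn_sum y) linear_sumlz.
apply: memv_suml => i _; rewrite linear_sumr; apply: memv_suml => j _ /=.
rewrite linearZl_LR linearZr_LR /=.
have [->|xi] := eqVneq (coordn i x) 0; first by rewrite scale0r mem0v.
have [->|yj] := eqVneq (coordn j y) 0; first by rewrite scale0r scaler0 mem0v.
by rewrite !rpredZ // XW.
Qed.

End Coordinates.

(** * Subalgebras in an adapted basis *)

Section AdaptedBasis.

Variables (K : fieldType) (E : vectType K) (mul : {bilinear E -> E -> E}).
Variables (n : nat) (b : n.-tuple E).

(* [P i] says that [b_i, b_{i+1}] come from a 2 x 2 block, as [e_i + e_{i+1}]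
   and [e_i - e_{i+1}]. *)
Record adapted (P : pred nat) : Prop := Adapted {
  ad_basis : basis_of {:E} b;
  ad_next : forall i, P i -> (i.+1 < n)%N && ~~ P i.+1;
  ad_comm : forall x y, mul x y = mul y x;
  ad_orth : forall i j, (i < j)%N -> ~~ (P i && (j == i.+1)) ->
    mul b`_i b`_j = 0;
  ad_sq_mem : forall i, mul b`_i b`_i \in flag b i;
  ad_sq_snd : forall i, P i -> mul b`_i.+1 b`_i.+1 = mul b`_i b`_i;
  ad_pr_mem : forall i, P i -> mul b`_i b`_i.+1 \in flag b i.+1;
  ad_sq_gen : forall i, (i.+1 < n)%N -> ~~ P i ->
    coordn b i (mul b`_i.+1 b`_i.+1) != 0;
  ad_pr_gen : forall i, P i -> coordn b i (mul b`_i b`_i.+1) != 0 }.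

Variable P : pred nat.
Hypothesis adP : adapted P.

Local Notation F := (flag b).
Local Notation c := (coordn b).
Let bB : basis_of {:E} b := ad_basis adP.
Let mulC : forall x y, mul x y = mul y x := ad_comm adP.

(** The last premise matters only for a product [f g] whose [f] is the last vector of [F k]: its
    leading term is [f], so the index does not drop. *)
Lemma ad_prod_mem i j k : (i < k)%N -> (P i -> j = i.+1 -> (j < k)%N) ->
  mul b`_i b`_j \in F k.-1.
Proof.
move=> ltik ltjk.
have [ltij|ltji|<-] := ltngtP i j.
- have [/andP[Pi /eqP dj]|nP] := boolP (P i && (j == i.+1)); last first.
    by rewrite (ad_orth adP) // mem0v.
  have := ltjk Pi dj; rewrite dj => ltSik.
  have /subvP := @flagS _ _ _ b i.+1 k.-1 ltac:(lia); apply.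
  exact: ad_pr_mem adP _ _.
- have [/andP[Pj /eqP di]|nP] := boolP (P j && (i == j.+1)); last first.
    by rewrite mulC (ad_orth adP) // mem0v.
  rewrite mulC di; have /subvP := @flagS _ _ _ b j.+1 k.-1 ltac:(lia); apply.
  exact: ad_pr_mem adP _ _.
- have /subvP := @flagS _ _ _ b i k.-1 ltac:(lia); apply.
  exact: ad_sq_mem adP _.
Qed.

(** The hypothesis says that [F k] does not end between the [f] and the [g] of a block; then even
    the products [f g] fall by one step. *)
Lemma ad_flag_ideal k x y : ~~ ((0 < k)%N && P k.-1) ->
  x \in F k -> mul x y \in F k.-1.
Proof.
move=> nPk /(mem_flag bB) x0; apply: (bilinear_mem bB) => i j _ _ xi _.
have ltik : (i < k)%N by rewrite ltnNge; apply: contraNN xi => /x0 ->.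
apply: ad_prod_mem => // Pi ->; rewrite ltn_neqAle ltik andbT.
by apply: contraNneq nPk => <-.
Qed.

Lemma ad_flag_mul k x y : x \in F k -> y \in F k -> mul x y \in F k.-1.
Proof.
move=> /(mem_flag bB) x0 /(mem_flag bB) y0.
apply: (bilinear_mem bB) => i j _ _ xi yj; apply: ad_prod_mem.
  by rewrite ltnNge; apply: contraNN xi => /x0 ->.
by move=> _ _; rewrite ltnNge; apply: contraNN yj => /y0 ->.
Qed.

Lemma ad_flag_mul_closed k x y : x \in F k -> y \in F k -> mul x y \in F k.
Proof.
move=> xF yF; have /subvP := @flagS _ _ _ b k.-1 k (leq_pred k); apply.
exact: ad_flag_mul.
Qed.

Lemma ad_fst_boundary i : P i -> ~~ ((0 < i)%N && P i.-1).
Proof.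
by case: i => [|i] //= Pi; apply/negP => /(ad_next adP)/andP[_]; rewrite Pi.
Qed.

Lemma ad_fst_not_snd i : P i -> ~~ P i.+1.
Proof. by case/(ad_next adP)/andP. Qed.

(** All terms other than [mul v v] are grouped into a single product with [w], to which
    [ad_flag_ideal] applies. *)
Lemma ad_sqD v w : mul (v + w) (v + w) = mul v v + mul w (v + v + w).
Proof.
rewrite linearDl (mulC v) linearDl [mul w (_ + _ + _)]linearDr [mul w (v + w)]linearDr.
by rewrite [mul w (v + v)]linearDr !addrA.
Qed.

(** The part of [u] below [b_{d+1}] lies in [F d.+1], whose products with any vector fall into [F d]
    since [d] is not an [f]. The square of the leading term alone decides the coordinate [d]. *)
Lemma ad_sq_descent d u : ~~ P d -> (d.+1 < n)%N ->
    u \in F d.+2 -> c d.+1 u != 0 ->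
  mul u u \in F d.+1 /\ c d (mul u u) != 0.
Proof.
move=> nPd ltd uF cu; split; first exact: (ad_flag_mul uF uF).
have := flag_subl bB uF; set w := _ - _ => wF.
have -> : u = c d.+1 u *: b`_d.+1 + w by rewrite /w subrKC.
set a := c _ u in cu *.
rewrite ad_sqD linearZl_LR linearZr_LR /= coordnD !coordnZ.
have -> : c d (mul w (a *: b`_d.+1 + a *: b`_d.+1 + w)) = 0.
  by have /(mem_flag bB) -> := @ad_flag_ideal d.+1 w (a *: b`_d.+1 + a *: b`_d.+1 + w) nPd wF.
by rewrite addr0 !mulf_neq0 // (ad_sq_gen adP).
Qed.

Lemma ad_pair_split d u : P d -> u \in F d.+2 ->
  exists2 w, w \in F d & u = c d.+1 u *: b`_d.+1 + c d u *: b`_d + w.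
Proof.
move=> Pd uF; have [ltd _] := andP (ad_next adP Pd).
have wF := flag_subl bB uF; have := flag_subl bB wF.
rewrite coordnB coordnZ (coordn_nth bB) // ltn_eqF // mulr0 subr0 => w'F.
by eexists; first exact: w'F; rewrite -addrA [X in _ + X]subrKC subrKC.
Qed.

(** As [f] and [g] have the same square, the only term of level [d] is the multiple of [f g],
    present when both coordinates of [u] are nonzero. If the [f]-coordinate is zero, the square
    drops by two steps. *)
Lemma ad_pair_sq d u : P d -> u \in F d.+2 ->
  exists2 w, w \in F d.-1 & mul u u =
    (c d.+1 u ^+ 2 + c d u ^+ 2) *: mul b`_d b`_d
      + (2 * c d.+1 u * c d u) *: mul b`_d b`_d.+1 + w.
Proof.
move=> Pd uF; have [w wF ->] := ad_pair_split Pd uF.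
have [ltd _] := andP (ad_next adP Pd).
have wd : forall i, (d <= i)%N -> c i w = 0 by apply/(mem_flag bB).
rewrite !coordnD !coordnZ !(coordn_nth bB) ?(ltnW ltd) // !eqxx.
have -> : (d.+1 == d) = false by rewrite gtn_eqF.
have -> : (d == d.+1) = false by rewrite ltn_eqF.
rewrite !wd // !mulr1 !mulr0 !addr0 add0r.
set a := c d.+1 u; set a' := c d u; set v := _ *: _ + _ *: _.
exists (mul w (v + v + w)).
  by apply: ad_flag_ideal wF; apply: ad_fst_boundary.
rewrite ad_sqD; congr (_ + _).
rewrite /v ad_sqD !linearZl_LR !linearZr_LR /= (ad_sq_snd adP Pd).
rewrite !linearDr !linearZr_LR /= !scalerDr !scalerA.
rewrite [X in _ + X = _]addrC addrA -!scalerDl.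
by congr (_ *: _ + _ *: _); ring.
Qed.

Definition reaches (U : {vspace E}) k : Prop :=
  exists u, [/\ u \in U, u \in F k.+1 & c k u != 0].

(* Multiplying by an element with leading term [g = b_{i+1}] turns an [f]-coordinate
   into a leading term [f = b_i]. *)
Lemma ad_reaches_fst (U : {vspace E}) i : subalgebra mul U -> P i ->
  2%:R != 0 :> K -> reaches U i.+1 -> ~~ vanish b U i -> reaches U i.
Proof.
move=> Ualg Pi K2 [u [uU uF cu]] /vanishPn[y yU cy].
have ciF z : z \in F i -> c i z = 0 by move/(mem_flag bB); apply.
have FS z : z \in F i.-1 -> z \in F i.
  by move=> zF; apply: (subvP (flagS b (leq_pred i))).
have FS1 z : z \in F i -> z \in F i.+1 by apply/subvP/flagS.
(* If [u] itself has a nonzero [f]-coordinate, the cross term of its square already has leading term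
   [f]. *)
have [cui|cui] := eqVneq (c i u) 0; last first.
  exists (mul u u); split; first exact: Ualg.
    exact: (ad_flag_mul uF uF).
  have [w /FS wF ->] := ad_pair_sq Pi uF.
  rewrite !coordnD !coordnZ (ciF w) // (ciF _ (ad_sq_mem adP i)) mulr0 add0r addr0.
  by rewrite !mulf_neq0 // (ad_pr_gen adP).
have [w wF def_u] := ad_pair_split Pi uF; rewrite cui scale0r addr0 in def_u.
have [lti _] := andP (ad_next adP Pi).
have nPi1 := ad_fst_not_snd Pi.
have e1 : (i == i.+1) = false by rewrite ltn_eqF.
have e2 : (i.+1 == i) = false by rewrite gtn_eqF.
(* Among the basis vectors only [f] and [g] themselves can have a nonzero product with [g], so the
   rest [z] of [y] disappears from [g y], even though [y] need not lie in a low term of the flag. *)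
have yD : exists2 z, mul b`_i.+1 z = 0 & y = c i.+1 y *: b`_i.+1 + c i y *: b`_i + z.
  exists (y - (c i.+1 y *: b`_i.+1 + c i y *: b`_i)); last by rewrite subrKC.
  set z := _ - _; apply/eqP; rewrite -memv0; apply: (bilinear_mem bB) => k j _ ltj.
  rewrite (coordn_nth bB) //; have [-> _|_] := eqVneq k i.+1; last by rewrite eqxx.
  rewrite memv0 => zj; apply/eqP.
  have nji : j != i.
    apply: contraNneq zj => ->; rewrite !coordnB !coordnD !coordnZ.
    by rewrite !(coordn_nth bB) ?(ltnW lti) // eqxx e1 mulr0 mulr1 add0r subrr.
  have nji1 : j != i.+1.
    apply: contraNneq zj => ->; rewrite !coordnB !coordnD !coordnZ.
    by rewrite !(coordn_nth bB) ?(ltnW lti) // eqxx e2 mulr0 mulr1 addr0 subrr.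
  have [ltj'|leq'] := ltnP i.+1 j; first by rewrite (ad_orth adP) // negb_and nPi1.
  rewrite mulC (ad_orth adP) //; first by rewrite ltn_neqAle nji1.
  by apply: contraNN nji => /andP[_]; rewrite eqSS eq_sym.
have [z bz def_y] := yD.
exists (mul u y); split; first exact: Ualg.
  rewrite def_u linearDl linearZl_LR /= rpredD //; last first.
    exact/FS1/FS/ad_flag_ideal/wF/ad_fst_boundary.
  rewrite def_y !linearDr !linearZr_LR /= bz addr0 rpredZ // rpredD // rpredZ //.
    by rewrite (ad_sq_snd adP) // FS1 // (ad_sq_mem adP).
  by rewrite mulC (ad_pr_mem adP).
have cwy : c i (mul w y) = 0 by apply/ciF/FS/ad_flag_ideal/wF/ad_fst_boundary.
rewrite {1}def_u linearDl linearZl_LR /= coordnD coordnZ cwy addr0.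
rewrite {1}def_y !linearDr !linearZr_LR /= bz addr0 coordnD !coordnZ.
rewrite (ad_sq_snd adP) // (ciF _ (ad_sq_mem adP i)) mulr0 add0r.
by rewrite !mulf_neq0 // mulC (ad_pr_gen adP).
Qed.

Hypothesis K2 : 2%:R != 0 :> K.

(** Descent from [d] by squaring. Each index is reached from the next one, or, when the next one is
    an [f] vanishing on [U], from the [g] above it, since [g ^ 2 = f ^ 2] has its leading term just
    below the block. *)
Lemma ad_reaches (U : {vspace E}) d k : subalgebra mul U ->
    (U <= F d.+1)%VS -> ~~ (U <= F d)%VS -> (k <= d)%N ->
  reaches U k \/ P k && vanish b U k.
Proof.
move=> Ualg UF nUF.
have reach_d : reaches U d.
  case/subvPn: nUF => u uU nuF; exists u; split=> //; first exact: (subvP UF).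
  apply: contraNneq nuF => cu; apply: (flag_pred bB) => //; exact: (subvP UF).
have lt_dn : (d < n)%N.
  by rewrite ltnNge; apply: contraNN nUF => /(flagf bB) ->; rewrite subvf.
move=> lekd; have [m] := ubnP (d - k); elim: m k lekd => // m IHm k lekd ltm.
have [->|nkd] := eqVneq k d; first by left.
have ltkd : (k < d)%N by rewrite ltn_neqAle nkd.
have [//|/andP[Pk1 vk1]] := IHm k.+1 ltkd ltac:(lia).
  have [Pk|nPk] := boolP (P k) => reach1.
    case: (boolP (vanish b U k)) => vk; first by right.
    by left; apply: ad_reaches_fst.
  left; have [u [uU uF cu]] := reach1.
  have [] := ad_sq_descent nPk _ uF cu; first lia.
  by exists (mul u u); split=> //; apply: Ualg.
(* Here [k.+1] is an [f] that vanishes on [U]. It differs from [d], where [U] has a nonzero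
   coordinate, so the index of [g] is still available. *)
left; have ltk2 : (k.+2 <= d)%N.
  have [//|ltdk|eq_d] := ltngtP k.+1 d; first by rewrite ltnNge ltkd in ltdk.
  case: reach_d => u [uU _]; rewrite -eq_d.
  by move/vanishP: vk1 => -> //; rewrite eqxx.
have [[u [uU uF cu]]|/andP[]] := IHm k.+2 ltk2 ltac:(lia); last first.
  by rewrite (negPf (ad_fst_not_snd Pk1)).
have cu1 : c k.+1 u = 0 by move/vanishP: vk1; apply.
have [w wF uu] := ad_pair_sq Pk1 uF; rewrite cu1 mulr0 scale0r addr0 expr0n addr0 in uu.
have nPk : ~~ P k by have := ad_fst_boundary Pk1.
exists (mul u u); split; first exact: Ualg.
  rewrite uu rpredD ?rpredZ ?(ad_sq_mem adP) //.
  exact: (subvP (flagS b (leqnSn k))).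
rewrite uu coordnD coordnZ.
have -> : c k w = 0 by move/(mem_flag bB): wF; apply.
by rewrite addr0 mulf_neq0 ?expf_neq0 // (ad_sq_gen adP) //; lia.
Qed.

(** Elimination from the top: at a reached index the leading coefficient is removed by a multiple of
    an element of [U], which respects the equations; at any other index the coefficient is zero by
    one of these equations. *)
Lemma ad_subalgP (U : {vspace E}) d x : subalgebra mul U ->
    (U <= F d)%VS -> (forall d', (U <= F d')%VS -> (d <= d')%N) ->
  x \in F d -> (forall i, P i -> vanish b U i -> c i x = 0) -> x \in U.
Proof.
move=> Ualg UF dmin.
suff memU m y : (m <= d)%N -> y \in F m ->
  (forall i, P i -> vanish b U i -> c i y = 0) -> y \in U by apply: memU.
elim: m y => [|m IHm] {}x ltmd xF x0.
  by move: xF; rewrite flag0 memv0 => /eqP ->; apply: mem0v.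
case: d UF dmin IHm ltmd => // d UF dmin IHm lemd.
have nUF : ~~ (U <= F d)%VS by apply/negP => /dmin; rewrite ltnn.
have [[u [uU uF cu]]|/andP[Pm vm]] := ad_reaches Ualg UF nUF lemd; last first.
  by apply: IHm => //; [exact: ltnW | apply: (flag_pred bB) => //; apply: x0].
set a := c m x / c m u; rewrite -(subrK (a *: u) x) rpredD ?rpredZ //.
apply: IHm; first exact: ltnW.
  apply: (flag_pred bB); first by rewrite rpredB // rpredZ.
  by rewrite coordnB coordnZ /a divfK // subrr.
by move=> i Pi vi; rewrite coordnB coordnZ x0 // (vanishP _ _ _ vi) // mulr0 subrr.
Qed.

Lemma ad_minimal_flag (U : {vspace E}) : exists2 d, (U <= F d)%VS &
  forall d', (U <= F d')%VS -> (d <= d')%N.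
Proof.
have ex : exists d, (U <= F d)%VS by exists n; rewrite (flagf bB) ?subvf.
by exists (ex_minn ex); case: ex_minnP.
Qed.

End AdaptedBasis.

Lemma bilinear_coordn0 (K : fieldType) (E : vectType K) n (X : n.-tuple E)
    (mul : {bilinear E -> E -> E}) k x y : basis_of {:E} X ->
    (forall i j, (i < n)%N -> (j < n)%N -> coordn X i x != 0 ->
       coordn X j y != 0 -> coordn X k (mul X`_i X`_j) = 0) ->
  coordn X k (mul x y) = 0.
Proof.
move=> XB X0; rewrite (coordn_sum XB x) (coordn_sum XB y) linear_sumlz.
rewrite linear_sum big1 // => i _; rewrite linear_sumr linear_sum big1 // => j _.
rewrite linearZl_LR linearZr_LR /= !coordnZ.
have [->|xi] := eqVneq (coordn X i x) 0; first by rewrite mul0r.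
have [->|yj] := eqVneq (coordn X j y) 0; first by rewrite mul0r mulr0.
by rewrite X0 // !mulr0.
Qed.

Lemma modular_of_sums (K : fieldType) (E : vectType K)
    (mul : {bilinear E -> E -> E}) :
  (forall U V, subalgebra mul U -> subalgebra mul V -> subalgebra mul (U + V)%VS) ->
  modular mul.
Proof.
move=> sums; have genE U V : subalgebra mul U -> subalgebra mul V ->
    forall x, in_gen mul [predU U & V] x <-> x \in (U + V)%VS.
  move=> Ualg Valg x; split=> [genx|/memv_addP[u uU [v vV ->]] A Aalg UVA].
    apply: genx; first exact: sums.
    by move=> y /orP[yU|yV]; [apply: (subvP (addvSl U V)) | apply: (subvP (addvSr U V))].
  by apply: rpredD; apply: UVA; apply/orP; [left | right].
move=> U V W Ualg Valg Walg UW x.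
have VWalg : subalgebra mul (V :&: W)%VS.
  by move=> y z /memv_capP[yV yW] /memv_capP[zV zW]; rewrite memv_cap Valg ?Walg.
have -> := genE _ _ Ualg VWalg x; have -> := genE _ _ Ualg Valg x.
by rewrite vspace_modl // memv_cap; split=> [/andP|[-> ->]].
Qed.

(** * Sums of subalgebras *)

Section SubalgebraSums.

Variables (K : fieldType) (E : vectType K) (mul : {bilinear E -> E -> E}).
Variables (n : nat) (b : n.-tuple E) (P : pred nat).
Hypotheses (adP : adapted mul b P) (K2 : 2%:R != 0 :> K).

Local Notation F := (flag b).
Local Notation c := (coordn b).
Let bB : basis_of {:E} b := ad_basis adP.

(** The absence of obstructions in adapted coordinates. If the kernel of [c i] in [F t] is a
    subalgebra containing the common square of the vectors [f] and [g] of block [t], either of them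
    can be adjoined to it; their product must then stay in the kernel of [c i]. *)
Hypothesis noobs : forall i t, P i -> P t -> (i < t)%N ->
  (forall x y, x \in F t -> y \in F t -> c i x = 0 -> c i y = 0 ->
     c i (mul x y) = 0) ->
  c i (mul b`_t b`_t) = 0 -> c i (mul b`_t b`_t.+1) = 0.

Lemma ad_nth_mem (U : {vspace E}) d s : subalgebra mul U ->
    (U <= F d)%VS -> (forall d', (U <= F d')%VS -> (d <= d')%N) ->
  (s < d)%N -> ~~ (P s && vanish b U s) -> b`_s \in U.
Proof.
move=> Ualg UF dmin ltsd nvs; have ltsn : (s < n)%N.
  by apply: leq_trans ltsd _; apply: dmin; rewrite (flagf bB) ?subvf.
apply: (ad_subalgP adP K2 Ualg UF dmin); first exact: (nth_flag bB).
move=> i Pi vi; rewrite (coordn_nth bB) //; case: eqVneq => // eq_is.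
by rewrite -eq_is Pi vi in nvs.
Qed.

(* If [c i] vanishes on [U], then [U] contains every [b_s] except the [f]-vectors of
   the blocks where [f] vanishes on [U]; for these, [noobs] applies, the products
   of the lower blocks being settled first. *)
Lemma ad_ker_closed (U : {vspace E}) d i : subalgebra mul U ->
    (U <= F d)%VS -> (forall d', (U <= F d')%VS -> (d <= d')%N) ->
    P i -> vanish b U i ->
  forall x y, x \in F d -> y \in F d -> c i x = 0 -> c i y = 0 ->
  c i (mul x y) = 0.
Proof.
move=> Ualg UF dmin Pi vi.
have d_n : (d <= n)%N by apply: dmin; rewrite (flagf bB) ?subvf.
have c0U x : x \in U -> c i x = 0 by move/vanishP: vi; apply.
have sq0 s : (s < d)%N -> c i (mul b`_s b`_s) = 0.
  move=> ltsd; have [/andP[Ps vs]|] := boolP (P s && vanish b U s); last first.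
    by move=> /(ad_nth_mem Ualg UF dmin ltsd) sU; apply/c0U/Ualg.
  have [ltS|leS] := ltnP s.+1 d.
    rewrite -(ad_sq_snd adP Ps); apply/c0U.
    by apply: (Ualg); apply: (ad_nth_mem Ualg UF dmin ltS); rewrite (negPf (ad_fst_not_snd adP Ps)).
  (* The [g] of this block is outside [F d], so its [f] is the last vector of [F d]; as it vanishes
     on [U], the minimality of [d] fails. *)
  have eq_d : d = s.+1 by apply/eqP; rewrite eqn_leq leS.
  rewrite eq_d in UF dmin.
  suff /dmin : (U <= F s)%VS by rewrite ltnn.
  apply/subvP => u uU; apply: (flag_pred bB); first exact: (subvP UF).
  exact: (vanishP _ _ _ vs).
have prod0 k s t : (s < k)%N -> (t < k)%N -> (k <= d)%N -> s != i -> t != i ->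
    c i (mul b`_s b`_t) = 0.
  elim: k s t => // k IHk s t.
  wlog lest : s t / (s <= t)%N.
    move=> IH; have [/IH//|ltts] := leqP s t; move=> *.
    by rewrite (ad_comm adP) IH // ltnW.
  move=> lts ltt ltkd si ti; move: lest; rewrite leq_eqVlt => /predU1P[->|ltst].
    by apply: sq0; apply: leq_trans ltt _.
  have [/andP[Ps /eqP dt]|/(ad_orth adP ltst) ->] := boolP (P s && (t == s.+1)); last first.
    exact: linear0.
  rewrite dt in ltt *.
  have [ltsi|] := ltnP s i.
    by have /(mem_flag bB) -> := ad_pr_mem adP Ps.
  rewrite leq_eqVlt eq_sym (negPf si) /= => ltis.
  apply: noobs => //; last by apply: sq0; apply: leq_trans ltkd; apply: ltnW.
  move=> x y /(mem_flag bB) xF /(mem_flag bB) yF xi yi.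
  apply: bilinear_coordn0 => // s' t' _ _ xs yt; apply: IHk.
  - by apply: ltn_trans (ltt : s < k)%N; rewrite ltnNge; apply: contraNN xs => /xF ->.
  - by apply: ltn_trans (ltt : s < k)%N; rewrite ltnNge; apply: contraNN yt => /yF ->.
  - exact: ltnW.
  - by apply: contraNneq xs => ->; rewrite xi.
  - by apply: contraNneq yt => ->; rewrite yi.
move=> x y /(mem_flag bB) xF /(mem_flag bB) yF xi yi.
apply: bilinear_coordn0 => // s t _ _ xs yt; apply: (prod0 d) => //.
- by rewrite ltnNge; apply: contraNN xs => /xF ->.
- by rewrite ltnNge; apply: contraNN yt => /yF ->.
- by apply: contraNneq xs => ->; rewrite xi.
- by apply: contraNneq yt => ->; rewrite yi.
Qed.

(** The sum is cut out of the larger flag term by the equations common to [U] and [V]. Each is an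
    equation of the subalgebra with the larger flag term, so [ad_ker_closed] applies to it. *)
Lemma ad_sum_subalgebra (U V : {vspace E}) :
  subalgebra mul U -> subalgebra mul V -> subalgebra mul (U + V)%VS.
Proof.
move=> Ualg Valg.
have [d UF dmin] := ad_minimal_flag adP U.
have [d' VF d'min] := ad_minimal_flag adP V.
wlog ledd' : U V Ualg Valg d d' UF dmin VF d'min / (d <= d')%N.
  move=> IH; have [led|/ltnW led] := leqP d d'; first exact: (IH U V _ _ d d').
  by rewrite addvC; apply: (IH V U _ _ d' d).
have UF' : (U <= F d')%VS := subv_trans UF (flagS b ledd').
have sumP x : x \in (U + V)%VS <-> x \in F d' /\
    forall i, P i -> vanish b U i -> vanish b V i -> c i x = 0.
  split=> [/memv_addP[u uU [v vV ->]]|[xF x0]].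
    split; first by apply: rpredD; [apply: (subvP UF') | apply: (subvP VF)].
    move=> i _ /vanishP U0 /vanishP V0.
    by rewrite coordnD U0 // V0 // addr0.
  (* [u] carries the [f]-coordinates of [x] that are free in [U]; once they are removed, [x]
     satisfies every equation of [V]. *)
  pose u := \sum_(i < n | P i && ~~ vanish b U i) c i x *: b`_i.
  have uU : u \in U.
    apply: memv_suml => i /andP[Pi nvi]; apply/memvZ.
    apply: (ad_nth_mem Ualg UF dmin); last by rewrite Pi.
    have [y yU yi] := vanishPn _ _ _ nvi.
    rewrite ltnNge; apply: contraNN yi => led; apply/eqP.
    by move: (i : nat) led; apply/(mem_flag bB)/(subvP UF).
  rewrite -(subrK u x) addrC memv_add //.
  apply: (ad_subalgP adP K2 Valg VF d'min); first by apply: rpredB => //; apply: (subvP UF').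
  move=> i Pi vVi; rewrite coordnB /u linear_sum /=.
  have [ltin|lein] := ltnP i n; last first.
    by rewrite big1 ?coordn_ge ?subr0 // => j _; rewrite coordn_ge.
  have [vUi|nvi] := boolP (vanish b U i).
    rewrite x0 // big1 ?subr0 // => j /andP[_ nvj].
    rewrite coordnZ (coordn_nth bB) //; case: eqVneq => [eq_ij|]; last by rewrite mulr0.
    by rewrite -eq_ij vUi in nvj.
  rewrite (bigD1 (Ordinal ltin)) ?Pi //= big1 => [|j /andP[_ nij]].
    by rewrite coordnZ (coordn_nth bB) // eqxx mulr1 addr0 subrr.
  rewrite coordnZ (coordn_nth bB) //; case: eqVneq => [eq_ij|]; last by rewrite mulr0.
  by case/eqP: nij; apply: val_inj.
move=> x y /sumP[xF x0] /sumP[yF y0]; apply/sumP; split.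
  exact: (ad_flag_mul_closed adP xF yF).
move=> i Pi vUi vVi.
by apply: (ad_ker_closed Valg VF d'min Pi vVi) => //; [apply: x0 | apply: y0].
Qed.

Lemma ad_modular : modular mul.
Proof. exact/modular_of_sums/ad_sum_subalgebra. Qed.

End SubalgebraSums.

(** * Normal forms *)

Section NormalFormEntries.

Variable K : fieldType.

Definition pair_at n (A : 'M[K]_n) (i i' : 'I_n) : Prop :=
  [/\ i' = i.+1 :> nat, A i i = 1, A i i' = 1, A i' i = -1 & A i' i' = -1].

(** Block triangularity stated entry by entry, without dependent block sizes: on or above the
    diagonal, a nonzero entry sits in the first row of a 2 x 2 block or on the diagonal of its
    second row. *)
Definition triangular_entries n (A : 'M[K]_n) : Prop := forall i j : 'I_n,
  (i <= j)%N -> A i j != 0 ->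
  (exists k, pair_at A i k /\ (j = i \/ j = k)) \/
  (exists k, pair_at A k i /\ j = i).

Lemma normal_block_entries p (M : 'M[K]_p) : normal_block M ->
  (forall a b, M a b = 0) \/
  (exists a0 a1 : 'I_p, [/\ a1 = a0.+1 :> nat, forall a, a = a0 \/ a = a1,
     forall b, M a0 b = 1 & forall b, M a1 b = -1]).
Proof.
case; first by left=> a b; rewrite mxE.
right; exists ord0, ord_max; split=> // [a|b|b]; rewrite ?mxE ?expr0 ?expr1 //.
by case: a => [[|[|a]] lta] //; [left | right]; apply: val_inj.
Qed.

Lemma normal_form_entries n (A : 'M[K]_n) : normal_form_mx A -> triangular_entries A.
Proof.
move=> [[m [p [eq_n [D [defA tri diag]]]]] _].
case: _ / eq_n in A defA *; rewrite castmx_id in defA.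
have AR i j (a : 'I_(p i)) (b : 'I_(p j)) :
    A (tagnat.Rank i a) (tagnat.Rank j b) = D i j a b.
  by have /matrixP/(_ a b) := mxblockK D i j; rewrite -defA mxE.
move=> s t; rewrite -[s]tagnat.sig2K -[t]tagnat.sig2K.
move: (tagnat.sig1 s) (tagnat.sig2 s) (tagnat.sig1 t) (tagnat.sig2 t) => {s t}.
move=> i a j b lest; rewrite AR.
have [/tri ->|lji Dn0] := ltnP i j; first by rewrite mxE eqxx.
(* Blocks occupy consecutive intervals of indices, so a column at or after the row cannot belong to
   an earlier block. *)
have eq_ij : i = j.
  apply/val_inj/eqP; rewrite eqn_leq lji andbT leqNgt; apply: contraL lest => ltji.
  rewrite -ltnNge !tagnat.RankEsum.
  have -> : (\sum_(k < m | (k < i)%N) p k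
      = \sum_(k < m | (k < j)%N) p k + \sum_(k < m | (j <= k < i)%N) p k)%N.
    rewrite (bigID (fun k : 'I_m => (k < j)%N)) /=; congr (_ + _)%N; apply: eq_bigl => k; lia.
  rewrite -addnA ltn_add2l (bigD1 j) /=; last by rewrite leqnn.
  by have := ltn_ord b; lia.
case: _ / eq_ij in b lest Dn0 {lji} *.
case: (normal_block_entries (diag i)) => [D0|[a0 [a1 [a01 a_or D0 D1]]]].
  by rewrite D0 eqxx in Dn0.
have pair01 : pair_at A (tagnat.Rank i a0) (tagnat.Rank i a1).
  by rewrite /pair_at !AR !D0 !D1 !tagnat.RankEsum a01 addnS.
case: (a_or a) (a_or b) lest => -> [] -> lest; [left|left| |right].
- by exists (tagnat.Rank i a1); split=> //; left.
- by exists (tagnat.Rank i a1); split=> //; right.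
- by move: lest; rewrite !tagnat.RankEsum a01 leq_add2l ltnn.
- by exists (tagnat.Rank i a0).
Qed.

Lemma normal_blockI q (M : 'M[K]_q) :
  (q = 1%N /\ forall a b, M a b = 0) \/ (q = 2%N /\ forall a b, M a b = (-1) ^+ a) ->
  normal_block M.
Proof.
case=> [[q1 M0]|[q2 M2]].
  rewrite q1 in M M0 *; have -> : M = 0 by apply/matrixP => a b; rewrite M0 mxE.
  exact: NormalBlock1.
rewrite q2 in M M2 *; have -> : M = nilblock K by apply/matrixP => a b; rewrite M2 mxE.
exact: NormalBlock2.
Qed.

(** Blocks do not overlap: the shared diagonal entry would be both [-1] and [1]. *)
Lemma pair_at_uniq n (A : 'M[K]_n) i j k : 2%:R != 0 :> K -> pair_at A i j -> pair_at A j k -> False.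
Proof.
move=> K2 [_ _ _ _ Aj] [_ Aj' _ _ _]; case/eqP: K2.
by rewrite (natrD _ 1 1) -{1}Aj' Aj addNr.
Qed.

(** [s] lists the sizes of consecutive diagonal blocks filling the indices below [r], and [o] is the
    offset of block [k]. *)
Definition good_sizes n (A : 'M[K]_n) (s : seq nat) r : Prop :=
  sumn s = r /\ forall k, (k < size s)%N -> let o := sumn (take k s) in
  (nth 0%N s k = 1%N /\ forall x : 'I_n, x = o :> nat -> A x x = 0) \/
  (nth 0%N s k = 2%N /\
   forall x y : 'I_n, x = o :> nat -> y = o.+1 :> nat -> pair_at A x y).

Lemma good_sizes_rcons n (A : 'M[K]_n) s r z : good_sizes A s r ->
    (z = 1%N /\ forall x : 'I_n, x = r :> nat -> A x x = 0) \/
    (z = 2%N /\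
     forall x y : 'I_n, x = r :> nat -> y = r.+1 :> nat -> pair_at A x y) ->
  good_sizes A (rcons s z) (r + z).
Proof.
case=> sum_s good_s good_z; split; first by rewrite -cats1 sumn_cat /= sum_s addn0.
move=> k; rewrite size_rcons ltnS leq_eqVlt => /predU1P[->|ltk] /=.
  by rewrite nth_rcons ltnn eqxx -cats1 take_size_cat // sum_s.
by rewrite nth_rcons ltk -cats1 takel_cat ?(ltnW ltk) //; apply: good_s.
Qed.

Lemma entries_good_sizes n (A : 'M[K]_n) : 2%:R != 0 :> K -> triangular_entries A ->
  exists s, good_sizes A s n.
Proof.
move=> K2 triA.
(* The induction is over the cuts [r] that do not split a block, that is, where [r] is not the
   second index of a pair. *)
suff ex_s r : (r <= n)%N -> (forall x y, pair_at A x y -> y <> r :> nat) ->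
    exists s, good_sizes A s r.
  by apply: ex_s => // x y _ eq_y; have := ltn_ord y; rewrite eq_y ltnn.
have [m] := ubnP r; elim: m r => // m IHm [_ _ _|r ltrm ltrn nosnd].
  by exists [::]; split.
pose z := Ordinal ltrn.
have [/forallP nsnd|] := boolP [forall x : 'I_n, forall y : 'I_n,
    (y == z) ==> ~~ [&& y == x.+1 :> nat, A x x == 1, A x y == 1, A y x == -1
                      & A y y == -1]].
  have {}nsnd x y : pair_at A x y -> y <> r :> nat.
    case=> e1 e2 e3 e4 e5 eq_y; have /forallP/(_ y)/implyP := nsnd x.
    have yz : y = z by apply: val_inj.
    by rewrite yz eqxx -yz e1 e2 e3 e4 e5 !eqxx => /(_ isT).
  have [||s good_s] := IHm r _ _ nsnd; [lia | exact: ltnW |].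
  exists (rcons s 1%N); rewrite -[r.+1]addn1; apply: good_sizes_rcons => //; left; split=> // x x_r.
  apply/eqP/negPn/negP => /(triA _ _ (leqnn _)) [] [k [pk _]].
    by case: (pk) => k_r _ _ _ _; apply: (nosnd x k pk); rewrite k_r x_r.
  exact: (nsnd k x).
case/forallPn => x /forallPn[y]; rewrite negb_imply negbK => /andP[/eqP yz].
case/and5P => /eqP e1 /eqP e2 /eqP e3 /eqP e4 /eqP e5.
have pxy : pair_at A x y by split.
have r_x : r = x.+1 by rewrite -e1 yz.
have [||t u ptu u_x|s good_s] := IHm x; [lia|lia| |].
  have {}u_x : u = x by apply: val_inj.
  by rewrite u_x in ptu; apply: (pair_at_uniq K2 ptu pxy).
exists (rcons s 2); have -> : r.+1 = (x + 2)%N by lia.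
apply: good_sizes_rcons => //; right; split=> // x' y' x'x y'y.
have -> : x' = x by apply: val_inj.
suff -> : y' = y by [].
by apply: val_inj; rewrite /= y'y e1.
Qed.

Lemma entries_normal_form n (A : 'M[K]_n) : 2%:R != 0 :> K -> triangular_entries A ->
  \rank A = n.-1 -> normal_form_mx A.
Proof.
move=> K2 triA rankA; split=> //.
have [s [sum_s good_s]] := entries_good_sizes K2 triA.
have offE (k : nat) : (k <= size s)%N ->
    (\sum_(i < size s | (i < k)%N) nth 0 s i)%N = sumn (take k s).
  move=> lek; rewrite -(big_ord_widen _ (nth 0%N s) lek) sumnE (big_nth 0%N) big_mkord.
  rewrite size_takel //; apply: eq_bigr => i _; by rewrite nth_take.
pose p (i : 'I_(size s)) := nth 0%N s i.
have eq_n : (\sum_i p i)%N = n by rewrite -sum_s sumnE (big_nth 0%N) big_mkord.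
have offRE (i : 'I_(size s)) (a : 'I_(p i)) :
    tagnat.Rank i a = (sumn (take i s) + a)%N :> nat.
  by rewrite tagnat.RankEsum offE // ltnW.
exists (size s), p, eq_n.
(* Replacing [n] by the sum of the block sizes turns the cast into the identity. *)
case: _ / eq_n in A triA good_s rankA sum_s *.
exists (submxblock A); split; first by rewrite castmx_id submxblockK.
- move=> i j ltij; apply/matrixP => a b; rewrite !mxE; apply/eqP/negPn/negP.
  have [lta ltb] := (ltn_ord a, ltn_ord b).
  have leij : (sumn (take i s) + p i <= sumn (take j s))%N.
    rewrite -(subnKC ltij) -[X in (_ <= sumn X)%N](cat_take_drop i.+1) take_takel ?leq_addr //.
    by rewrite (take_nth 0%N) // -cats1 !sumn_cat /= addn0 leq_addr.
  have [eRa eRb] := (offRE i a, offRE j b).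
  case/triA=> [|[k [pk kb]]|[k [pk kb]]].
  + by rewrite eRa eRb; lia.
  + have [ek Axx _ _ _] := pk.
    case: (good_s i (ltn_ord i)) => /= [[pi1 A0]|[pi2 A2]].
      move: Axx; rewrite A0; last by have {}pi1 : p i = 1%N := pi1; rewrite eRa; lia.
      by move/eqP; rewrite eq_sym oner_eq0.
    have {}pi2 : p i = 2%N := pi2.
    (* In the first row of a block of size 2 the column [k] would still be inside that block; the
       second row would also be the first row of another pair. *)
    have [a0|a1] : a = 0%N :> nat \/ a = 1%N :> nat by lia.
      by case: kb => e; move: eRb; rewrite e; lia.
    have lt0 : (0 < p i)%N by rewrite [p i]pi2.
    have := A2 (tagnat.Rank i (Ordinal lt0)) (tagnat.Rank i a).
    rewrite !offRE /= a1 addn0 addn1 => /(_ erefl erefl) p01.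
    exact: (pair_at_uniq K2 p01 pk).
  + by move: eRb; rewrite kb eRa; lia.
- move=> i; apply: normal_blockI.
  case: (good_s i (ltn_ord i)) => /= [[pi1 A0]|[pi2 A2]].
    left; split=> // a b; rewrite mxE.
    have {}pi1 : p i = 1%N := pi1; have [lta ltb] := (ltn_ord a, ltn_ord b).
    have -> : b = a by apply: val_inj => /=; lia.
    by apply: A0; rewrite offRE; lia.
  right; split=> // a b; rewrite mxE.
  have lt0 : (0 < p i)%N by rewrite [p i]pi2.
  have lt1 : (1 < p i)%N by rewrite [p i]pi2.
  have aE (c : 'I_(p i)) : c = Ordinal lt0 \/ c = Ordinal lt1.
    have ltc := ltn_ord c; have {}pi2 : p i = 2%N := pi2.
    have [c0|c1] : c = 0%N :> nat \/ c = 1%N :> nat by lia.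
      by left; apply: val_inj.
    by right; apply: val_inj.
  have [||_ e1 e2 e3 e4] := A2 (tagnat.Rank i (Ordinal lt0)) (tagnat.Rank i (Ordinal lt1)).
  - by rewrite offRE addn0.
  - by rewrite offRE addn1.
  by case: (aE a) (aE b) => -> [] ->.
Qed.

End NormalFormEntries.

Section Products.

Variables (K : fieldType) (E : vectType K) (mul : {bilinear E -> E -> E}).
Implicit Types U V W : {vspace E}.

Lemma mem_mulv U V x y : x \in U -> y \in V -> mul x y \in mulv mul U V.
Proof.
move=> xU yV; rewrite (coord_vbasis xU) (coord_vbasis yV) linear_sumlz.
apply: memv_suml => i _; rewrite linear_sumr; apply: memv_suml => j _ /=.
rewrite linearZl_LR linearZr_LR /= !rpredZ //; apply: memv_span.
by apply/allpairsP; exists ((vbasis U)`_i, (vbasis V)`_j); rewrite !mem_nth ?size_tuple.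
Qed.

Lemma mulv_subP U V W :
  reflect (forall x y, x \in U -> y \in V -> mul x y \in W) (mulv mul U V <= W)%VS.
Proof.
apply: (iffP idP) => [sW x y xU yV | sW]; first exact: (subvP sW _ (mem_mulv xU yV)).
by apply/span_subvP => _ /allpairsP[[x y] /= [/vbasis_mem xU /vbasis_mem yV ->]]; apply: sW.
Qed.

Lemma natural_mulE n (B : n.-tuple E) x y : natural_basis mul B ->
  mul x y = \sum_(i < n) (coordn B i x * coordn B i y) *: mul B`_i B`_i.
Proof.
case=> bB orthB; rewrite {1}(coordn_sum bB x) {1}(coordn_sum bB y) linear_sumlz.
apply: eq_bigr => i _; rewrite linear_sumr (bigD1 i) //= big1 ?addr0 => [|j nji].
  by rewrite linearZl_LR linearZr_LR /= scalerA.
have := orthB i j; rewrite eq_sym => /(_ nji); rewrite !(tnth_nth 0) => eB.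
by rewrite linearZl_LR linearZr_LR /= eB !scaler0.
Qed.

Lemma natural_mulC n (B : n.-tuple E) x y : natural_basis mul B -> mul x y = mul y x.
Proof.
move=> natB; rewrite !(natural_mulE _ _ natB).
by apply: eq_bigr => i _; rewrite mulrC.
Qed.

End Products.

(** * The adapted basis of a normal form *)

Section NormalFormBasis.

Variables (K : fieldType) (E : vectType K) (mul : {bilinear E -> E -> E}).
Variables (n : nat) (B : n.-tuple E).
Hypotheses (K2 : 2%:R != 0 :> K) (natB : natural_basis mul B).
Hypothesis triB : triangular_entries (structure_matrix mul B).

Local Notation e i := (B`_i).
Local Notation c := (coordn B).
Local Notation q i := (mul (e i) (e i)).
Local Notation A := (structure_matrix mul B).
Let bB : basis_of {:E} B := proj1 natB.

(** A boolean form of [Lambda] on natural numbers, to be used as the predicate [P] of [adapted]. *)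
Definition is_fst (i : nat) : bool := [exists x : 'I_n, exists y : 'I_n,
  [&& x == i :> nat, y == x.+1 :> nat, A x x == 1, A x y == 1, A y x == -1
    & A y y == -1]].

Definition is_snd (i : nat) : bool := (0 < i)%N && is_fst i.-1.

Lemma is_fstP i : reflect (exists x y : 'I_n, x = i :> nat /\ Lambda mul B x y) (is_fst i).
Proof.
apply: (iffP existsP) => [[x /existsP[y /and5P[/eqP x_i /eqP e1 /eqP e2 /eqP e3]]]|].
  by case/andP=> /eqP e4 /eqP e5; exists x, y.
case=> x [y [x_i [e1 e2 e3 e4 e5]]]; exists x; apply/existsP; exists y.
by rewrite x_i e1 e2 e3 e4 e5 x_i !eqxx.
Qed.

Lemma structure_matrixE (i j : 'I_n) : A i j = c j (q i).
Proof. by rewrite mxE coordn_ord !(tnth_nth 0). Qed.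

Lemma is_fst_next i : is_fst i -> (i.+1 < n)%N && ~~ is_fst i.+1.
Proof.
case/is_fstP=> x [y [x_i Lxy]]; have [y_x _ _ _ _] := Lxy.
rewrite -x_i -y_x ltn_ord; apply/is_fstP => -[y' [z [y'y Lyz]]].
have eq_y : y' = y by apply: val_inj.
by rewrite eq_y in Lyz; apply: (pair_at_uniq K2 Lxy Lyz).
Qed.

Lemma is_fst_nsnd i : is_fst i -> ~~ is_snd i.
Proof.
by case: i => [|i] // Pi; apply/negP => /= /is_fst_next /andP[_]; rewrite Pi.
Qed.

Lemma is_fst_coord i : is_fst i ->
  [/\ c i (q i) = 1, c i.+1 (q i) = 1, c i (q i.+1) = -1 & c i.+1 (q i.+1) = -1].
Proof. by case/is_fstP=> x [y [<- [e1]]]; rewrite !structure_matrixE e1. Qed.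

Lemma entry_neq0 i j : (i < n)%N -> (i <= j)%N -> c j (q i) != 0 ->
  is_fst i && ((j == i) || (j == i.+1)) || is_snd i && (j == i).
Proof.
move=> ltin leij; have [ltjn|lenj] := ltnP j n; last by rewrite coordn_ge ?eqxx.
rewrite -[c j _](structure_matrixE (Ordinal ltin) (Ordinal ltjn)).
case/triB=> // -[k [Lk]].
  have -> : is_fst i by apply/is_fstP; exists (Ordinal ltin), k.
  by case: Lk => k_i _ _ _ _ [] /(congr1 val) /= ->; rewrite ?k_i eqxx ?orbT.
move=> /(congr1 val) /= ->; rewrite eqxx andbT; apply/orP; right.
have [/= k_i _ _ _ _] := Lk; rewrite /is_snd k_i /=.
by apply/is_fstP; exists k, (Ordinal ltin).
Qed.

Lemma single_sq i : ~~ is_fst i -> ~~ is_snd i -> q i \in flag B i.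
Proof.
move=> nf ns; have [ltin|lein] := ltnP i n; last first.
  by rewrite nth_default ?size_tuple // linear0r mem0v.
apply/(mem_flag bB) => j leij; apply/eqP/negPn/negP.
by move/(entry_neq0 ltin leij); rewrite (negPf nf) (negPf ns).
Qed.

Lemma pair_sq i : is_fst i ->
  q i - (e i + e i.+1) \in flag B i /\ q i.+1 + (e i + e i.+1) \in flag B i.
Proof.
move=> fi; have [lt1 nf1] := andP (is_fst_next fi); have lti := ltnW lt1.
have [e1 e2 e3 e4] := is_fst_coord fi.
have ne1 : (i == i.+1) = false by rewrite ltn_eqF.
have ne2 : (i.+1 == i) = false by rewrite gtn_eqF.
split; apply/(mem_flag bB) => j leij; rewrite ?coordnB !coordnD !(coordn_nth bB) //.
  have [->|nji] := eqVneq j i; first by rewrite e1 ne1 addr0 subrr.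
  have [->|nji1] := eqVneq j i.+1; first by rewrite e2 add0r subrr.
  rewrite addr0 subr0; apply/eqP/negPn/negP => /(entry_neq0 lti leij).
  by rewrite (negPf nji) (negPf nji1) !andbF.
have [->|nji] := eqVneq j i; first by rewrite e3 ne1 addr0 addNr.
have [->|nji1] := eqVneq j i.+1; first by rewrite e4 add0r addNr.
have leij1 : (i.+1 <= j)%N by rewrite ltn_neqAle eq_sym nji.
rewrite !addr0; apply/eqP/negPn/negP => /(entry_neq0 lt1 leij1).
by rewrite (negPf nf1) (negPf nji1) !andbF.
Qed.

Lemma pair_sq_sum i : is_fst i -> q i + q i.+1 \in flag B i.
Proof.
case/pair_sq=> m1 m2; have := rpredD m1 m2.
by rewrite addrACA addNr addr0.
Qed.

Lemma natural_orth i j : i != j -> mul (e i) (e j) = 0.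
Proof.
move=> nij; have [ltin|lein] := ltnP i n; last first.
  by rewrite [e i]nth_default ?size_tuple // linear0l.
have [ltjn|lejn] := ltnP j n; last first.
  by rewrite [e j]nth_default ?size_tuple // linear0r.
by have [_ /(_ (Ordinal ltin) (Ordinal ltjn) nij)] := natB; rewrite !(tnth_nth 0).
Qed.

Definition twist i : E :=
  if is_fst i then e i + e i.+1 else if is_snd i then e i.-1 - e i else e i.

Definition twisted : n.-tuple E := [tuple twist i | i < n].

Lemma nth_twisted i : (i < n)%N -> twisted`_i = twist i.
Proof. by move=> ltin; rewrite -[i]/(val (Ordinal ltin)) -tnth_nth tnth_mktuple. Qed.

Lemma twisted_fst i : is_fst i -> twisted`_i = e i + e i.+1.
Proof.
move=> fi; have [lti _] := andP (is_fst_next fi).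
by rewrite nth_twisted /twist ?fi // ltnW.
Qed.

Lemma twisted_snd i : is_fst i -> twisted`_i.+1 = e i - e i.+1.
Proof.
move=> fi; have [lti nf] := andP (is_fst_next fi).
by rewrite nth_twisted // /twist (negPf nf) /is_snd /= fi.
Qed.

Lemma twisted_single i : ~~ is_fst i -> ~~ is_snd i -> twisted`_i = e i.
Proof.
move=> nf ns; have [ltin|lein] := ltnP i n; last by rewrite !nth_default ?size_tuple.
by rewrite nth_twisted // /twist (negPf nf) (negPf ns).
Qed.

Variant index_spec i : Prop :=
  | IndexFst of is_fst i
  | IndexSnd k of is_fst k & i = k.+1
  | IndexSingle of ~~ is_fst i & ~~ is_snd i.

Lemma indexP i : index_spec i.
Proof.
have [fi|nf] := boolP (is_fst i); first exact: IndexFst.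
have [/andP[i0 fk]|ns] := boolP (is_snd i); last exact: IndexSingle.
by apply: (IndexSnd fk); rewrite prednK.
Qed.

(** Unless [d] separates the two vectors of a block, whole pairs are exchanged, and [e_i], [e_{i+1}]
    are recovered as half the sum and half the difference of [f] and [g]. *)
Lemma flag_twisted d : ~~ is_snd d -> flag twisted d = flag B d.
Proof.
move=> ns; have nsd k : is_fst k -> (k < d)%N -> (k.+1 < d)%N.
  move=> fk ltkd; rewrite ltn_neqAle ltkd andbT.
  by apply: contraNneq ns => <-.
have sub : (flag twisted d <= flag B d)%VS.
  apply/span_subvP => z /(nthP 0) [i]; rewrite size_take_min size_tuple leq_min.
  case/andP=> ltid ltin <-; rewrite nth_take //.
  case: (indexP i) => [fi|k fk i_k|nf ns'].
  - by rewrite twisted_fst // rpredD // (nth_flag bB) // nsd.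
  - rewrite i_k in ltid *; rewrite twisted_snd // rpredB // (nth_flag bB) //; exact: ltnW.
  - by rewrite twisted_single // (nth_flag bB).
have memt i : (i < d)%N -> (i < n)%N -> twisted`_i \in flag twisted d.
  move=> ltid ltin; rewrite -(nth_take 0 ltid); apply/memv_span/mem_nth.
  by rewrite size_take_min size_tuple leq_min ltid.
apply/eqP; rewrite eqEsubv sub; apply/span_subvP => z /(nthP 0) [i].
rewrite size_take_min size_tuple leq_min => /andP[ltid ltin] <-; rewrite nth_take //.
have half k : is_fst k -> (k < d)%N ->
    e k \in flag twisted d /\ e k.+1 \in flag twisted d.
  move=> fk ltkd; have [ltk _] := andP (is_fst_next fk).
  have m0 := memt k ltkd (ltnW ltk); have m1 := memt k.+1 (nsd _ fk ltkd) ltk.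
  have -> : e k = 2%:R^-1 *: (twisted`_k + twisted`_k.+1).
    rewrite twisted_fst // twisted_snd // addrACA subrr addr0 -mulr2n -scaler_nat.
    by rewrite scalerA mulVf // scale1r.
  have -> : e k.+1 = 2%:R^-1 *: (twisted`_k - twisted`_k.+1).
    rewrite twisted_fst // twisted_snd // opprB addrC addrA subrK.
    by rewrite -mulr2n -scaler_nat scalerA mulVf // scale1r.
  by split; apply: rpredZ; [apply: rpredD | apply: rpredB].
case: (indexP i) => [fi|k fk i_k|nf ns'].
- by have [] := half i fi ltid.
- by rewrite i_k in ltid *; have [] := half k fk (ltnW ltid).
- by rewrite -twisted_single // memt.
Qed.

End NormalFormBasis.

Section TwistedAdapted.

Variables (K : fieldType) (E : vectType K) (mul : {bilinear E -> E -> E}).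
Variables (n : nat) (B : n.-tuple E).
Hypotheses (K2 : 2%:R != 0 :> K) (natB : natural_basis mul B).
Hypothesis triB : triangular_entries (structure_matrix mul B).

Local Notation e i := (B`_i).
Local Notation q i := (mul (e i) (e i)).
Local Notation fst := (is_fst mul B).
Local Notation snd := (is_snd mul B).
Local Notation b := (twisted mul B).
Let bB : basis_of {:E} B := proj1 natB.

Lemma twisted_basis : basis_of {:E} b.
Proof.
have size_n : \dim {:E} = n := size_basis bB.
rewrite basisEdim size_tuple size_n leqnn andbT.
have nsn : ~~ snd n.
  apply/negP => /andP[n_gt0 /(is_fst_next K2)/andP[]].
  by move: n_gt0; lia.
have := flag_twisted K2 natB nsn; rewrite (flagf bB) //.
by rewrite /flag take_oversize ?size_tuple // => <-.
Qed.

Lemma twisted_sq_snd i : fst i ->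
  mul b`_i b`_i = q i + q i.+1 /\ mul b`_i.+1 b`_i.+1 = q i + q i.+1.
Proof.
move=> fi; rewrite (twisted_fst K2 fi) (twisted_snd K2 fi).
have e01 : mul (e i) (e i.+1) = 0 by rewrite (natural_orth natB) // ltn_eqF.
have e10 : mul (e i.+1) (e i) = 0 by rewrite (natural_orth natB) // gtn_eqF.
split; first by rewrite linearDl !linearDr /= e01 e10 addr0 add0r.
by rewrite linearBl !linearBr /= e01 e10 subr0 sub0r opprK.
Qed.

Lemma twisted_pr i : fst i -> mul b`_i b`_i.+1 = q i - q i.+1.
Proof.
move=> fi; rewrite (twisted_fst K2 fi) (twisted_snd K2 fi).
have e01 : mul (e i) (e i.+1) = 0 by rewrite (natural_orth natB) // ltn_eqF.
have e10 : mul (e i.+1) (e i) = 0 by rewrite (natural_orth natB) // gtn_eqF.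
by rewrite linearDl !linearBr /= e01 e10 subr0 sub0r.
Qed.

Lemma twisted_pr_mem i : fst i -> mul b`_i b`_i.+1 - 2%:R *: b`_i \in flag b i.
Proof.
move=> fi; rewrite (flag_twisted K2 natB (is_fst_nsnd K2 fi)) twisted_pr //.
have [m1 m2] := pair_sq K2 natB triB fi; rewrite (twisted_fst K2 fi).
suff <- : q i - (e i + e i.+1) - (q i.+1 + (e i + e i.+1))
  = q i - q i.+1 - 2%:R *: (e i + e i.+1) by apply: rpredB.
by rewrite [- (q i.+1 + _)]opprD addrACA -opprD -mulr2n -scaler_nat.
Qed.

Lemma twisted_orth i j : (i < j)%N -> ~~ (fst i && (j == i.+1)) -> mul b`_i b`_j = 0.
Proof.
have orth := natural_orth natB.
move=> ltij nij; case: (indexP mul B i) => [fi|k fk i_k|nf ns];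
  case: (indexP mul B j) => [fj|l fl j_l|nf' ns'].
- have ltij' : (i.+1 < j)%N.
    rewrite ltn_neqAle ltij andbT; apply: contraTneq fj => <-.
    by have [_ ->] := andP (is_fst_next K2 fi).
  rewrite !(twisted_fst K2) // linearDl !linearDr /= !orth ?addr0 //; lia.
- rewrite j_l in ltij nij *.
  have ltil : (i < l)%N.
    by rewrite ltn_neqAle -ltnS ltij andbT; apply: contraNneq nij => <-; rewrite fi /=.
  have ltil' : (i.+1 < l)%N.
    rewrite ltn_neqAle ltil andbT; apply: contraTneq fl => <-.
    by have [_ ->] := andP (is_fst_next K2 fi).
  rewrite (twisted_fst K2) // (twisted_snd K2) // linearDl !linearBr /= !orth ?subr0 ?addr0 //; lia.
- rewrite (twisted_fst K2) // twisted_single // linearDl /= !orth ?addr0 //; last lia.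
  by apply: contraNneq nij => <-; rewrite fi /=.
- rewrite i_k in ltij nij *.
  rewrite (twisted_snd K2) // (twisted_fst K2) // linearBl !linearDr /= !orth ?addr0 ?subr0 //; lia.
- rewrite i_k in ltij nij *; rewrite j_l in ltij nij *.
  have ltkl : (k.+1 < l)%N.
    rewrite ltn_neqAle -ltnS ltij andbT; apply: contraTneq fl => <-.
    by have [_ ->] := andP (is_fst_next K2 fk).
  rewrite !(twisted_snd K2) // linearBl !linearBr /= !orth ?subr0 //; lia.
- rewrite i_k in ltij nij *.
  rewrite (twisted_snd K2) // twisted_single // linearBl /= !orth ?subr0 //; lia.
- rewrite twisted_single // (twisted_fst K2) // linearDr /= !orth ?addr0 //; lia.
- rewrite j_l in ltij nij *.
  rewrite twisted_single // (twisted_snd K2) // linearBr /= !orth ?subr0 //; first lia.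
  by apply: contraNneq nf => ->.
- by rewrite !twisted_single // orth //; lia.
Qed.

Lemma twisted_sq_mem i : mul b`_i b`_i \in flag b i.
Proof.
case: (indexP mul B i) => [fi|k fk ->|nf ns].
- have [-> _] := twisted_sq_snd fi.
  by rewrite (flag_twisted K2 natB (is_fst_nsnd K2 fi)) (pair_sq_sum K2 natB triB fi).
- have [_ ->] := twisted_sq_snd fk; apply: (subvP (flagS b (leqnSn k))).
  by rewrite (flag_twisted K2 natB (is_fst_nsnd K2 fk)) (pair_sq_sum K2 natB triB fk).
- by rewrite (flag_twisted K2 natB ns) twisted_single // (single_sq natB triB).
Qed.

Lemma twisted_prod_mem i : fst i -> mul b`_i b`_i.+1 \in flag b i.+1.
Proof.
move=> fi; rewrite -(subrK (2%:R *: b`_i) (mul _ _)) rpredD //.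
  exact/(subvP (flagS b (leqnSn i)))/twisted_pr_mem.
by rewrite rpredZ // (nth_flag twisted_basis).
Qed.

Hypothesis dim_sq : (n.-1 <= \dim (mulv mul {:E} {:E}))%N.

(* The products of the [b_k] span the square of the algebra and fit in the flag
   with a shift by one; a further drop would make the square too small. *)
Lemma twisted_sq_gen i : (i.+1 < n)%N -> ~~ fst i ->
  coordn b i (mul b`_i.+1 b`_i.+1) != 0.
Proof.
move=> lti nf; apply/eqP => ci0.
(* One product per index, with [h k] in [flag b k]: at the index of a [g] it is [f g], because the
   square of [g] only repeats that of [f]. *)
pose h k := if snd k then mul b`_k.-1 b`_k else mul b`_k b`_k.
have hF k : h k \in flag b k.
  rewrite /h; case: ifP => [/andP[k_gt0 fk]|_]; last exact: twisted_sq_mem.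
  by have := twisted_prod_mem fk; rewrite prednK.
have mulC x y : mul x y = mul y x := natural_mulC x y natB.
have sqE : (mulv mul {:E} {:E} <= <<map h (iota 0 n)>>)%VS.
  have memh k : (k < n)%N -> h k \in <<map h (iota 0 n)>>%VS.
    by move=> ltk; apply/memv_span/map_f; rewrite mem_iota.
  have prh k : fst k -> mul b`_k b`_k.+1 \in <<map h (iota 0 n)>>%VS.
    move=> fk; have := memh k.+1; rewrite /h /is_snd /= fk; apply.
    by have [] := andP (is_fst_next K2 fk).
  apply/mulv_subP => x y _ _; apply: (bilinear_mem twisted_basis) => s t lts ltt _ _.
  have [ltst|ltts|<-] := ltngtP s t.
  - have [/andP[fs /eqP ->]|nst] := boolP (fst s && (t == s.+1)); first exact: prh.
    by rewrite twisted_orth // mem0v.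
  - have [/andP[ft /eqP ->]|nst] := boolP (fst t && (s == t.+1)); first by rewrite mulC prh.
    by rewrite mulC twisted_orth // mem0v.
  - case: (indexP mul B s) => [fs|k fk s_k|nfs ns].
    + by have := memh s lts; rewrite /h (negPf (is_fst_nsnd K2 fs)).
    + have [e1 e2] := twisted_sq_snd fk; rewrite s_k e2 -e1.
      have := memh k; rewrite /h (negPf (is_fst_nsnd K2 fk)); apply.
      by apply: leq_trans lts; rewrite s_k.
    + by have := memh s lts; rewrite /h (negPf ns).
(* If the coordinate vanished, the products [h 0], ..., [h i.+1] would all lie in [flag b i]; with
   the [n - i.+2] others they would span dimension at most [n - 2]. *)
have sub : (<<map h (iota 0 n)>> <= flag b i + <<map h (iota i.+2 (n - i.+2))>>)%VS.
  apply/span_subvP => z /mapP[k]; rewrite mem_iota add0n => /andP[_ ltk] ->{z}.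
  have [ltk1|lek1] := ltnP i.+1 k.
    apply: (subvP (addvSr _ _)); apply/memv_span/map_f; rewrite mem_iota ltk1 subnKC //.
  apply: (subvP (addvSl _ _)); move: lek1; rewrite leq_eqVlt => /predU1P[->|].
    apply: (flag_pred twisted_basis); first exact: hF.
    by rewrite /h /is_snd /= (negPf nf).
  by rewrite ltnS => leki; apply: (subvP (flagS b leki)); apply: hF.
have := leq_trans dim_sq (dimvS (subv_trans sqE sub)).
have [le_add _] := dimv_add_leqif (flag b i) <<map h (iota i.+2 (n - i.+2))>>.
move/leq_trans/(_ le_add); rewrite leqNgt => /negP; apply.
have := dim_span (map h (iota i.+2 (n - i.+2))); rewrite size_map size_iota.
by have := dim_flag_leq b i; lia.
Qed.

Lemma twisted_adapted : adapted mul b fst.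
Proof.
split; [exact: twisted_basis | by move=> i; apply: is_fst_next | | | | | | | ].
- by move=> x y; apply: natural_mulC natB.
- exact: twisted_orth.
- exact: twisted_sq_mem.
- by move=> i fi; have [-> ->] := twisted_sq_snd fi.
- exact: twisted_prod_mem.
- exact: twisted_sq_gen.
- move=> i fi; have [lti _] := andP (is_fst_next K2 fi).
  have /(mem_flag twisted_basis)/(_ i (leqnn i)) := twisted_pr_mem fi.
  rewrite coordnB coordnZ (coordn_nth twisted_basis) 1?ltnW // eqxx mulr1.
  by move/eqP; rewrite subr_eq0 => /eqP ->.
Qed.

(** The [f]-coordinate is half of the sum of the two natural coordinates. This translates the
    projections in the definition of an obstruction into equations [x_f = 0]. *)
Lemma coordn_twisted i x : fst i ->
  (coordn b i x == 0) = (coordn B i x + coordn B i.+1 x == 0).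
Proof.
move=> fi; have [lti nfi] := andP (is_fst_next K2 fi).
suff -> : coordn B i x + coordn B i.+1 x = 2%:R * coordn b i x.
  by rewrite mulf_eq0 (negPf K2).
rewrite {1 2}(coordn_sum twisted_basis x) !linear_sum -big_split /=.
rewrite (bigD1 (Ordinal (ltnW lti))) //= big1 ?addr0 => [|j nji].
  rewrite !coordnZ -mulrDr mulrC (twisted_fst K2) // !coordnD !(coordn_nth bB) ?(ltnW lti) //.
  by rewrite !eqxx ltn_eqF // gtn_eqF // addr0 add0r.
rewrite !coordnZ -mulrDr; apply/eqP; rewrite mulf_eq0; apply/orP; right; apply/eqP.
have {}nji : (j : nat) != i by apply: contraNneq nji => ji; apply/eqP/val_inj.
have ltj := ltn_ord j.
case: (indexP mul B j) => [fj|k fk j_k|nf ns].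
- have [ltj1 nfj] := andP (is_fst_next K2 fj).
  rewrite (twisted_fst K2) // !coordnD !(coordn_nth bB) // !eqSS.
  rewrite [i == j]eq_sym (negPf nji) /=.
  have -> : (i == j.+1) = false by apply: contraNF nfj => /eqP <-.
  have -> : (i.+1 == j) = false by apply: contraNF nfi => /eqP ->.
  by rewrite !addr0.
- rewrite j_k in ltj *; rewrite (twisted_snd K2) // !coordnB !(coordn_nth bB) // ?(ltnW ltj) //.
  have [ltk1 nfk] := andP (is_fst_next K2 fk).
  rewrite eqSS.
  have -> : (i == k.+1) = false by apply: contraNF nfk => /eqP <-.
  have -> : (i.+1 == k) = false by apply: contraNF nfi => /eqP ->.
  by rewrite subr0 sub0r subrr.
- rewrite twisted_single // !(coordn_nth bB) // [i == j]eq_sym (negPf nji).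
  have -> : (i.+1 == j) = false by apply: contraNF ns => /eqP <-.
  by rewrite addr0.
Qed.

End TwistedAdapted.

Lemma coordn_span0 (K : fieldType) (E : vectType K) n (X : n.-tuple E) i
    (Y : seq E) x :
  {in Y, forall y, coordn X i y = 0} -> x \in <<Y>>%VS -> coordn X i x = 0.
Proof.
move=> Y0 xY; rewrite [x](coord_span (X := in_tuple Y)) // linear_sum big1 // => j _.
by rewrite linearZ /= Y0 ?mulr0 // mem_nth.
Qed.

(** * Obstructions *)

Section Obstructions.

Variables (K : fieldType) (E : vectType K) (mul : {bilinear E -> E -> E}).
Variables (n : nat) (B : n.-tuple E).
Hypotheses (K2 : 2%:R != 0 :> K) (natB : natural_basis mul B).
Hypothesis triB : triangular_entries (structure_matrix mul B).
Hypothesis dim_sq : (n.-1 <= \dim (mulv mul {:E} {:E}))%N.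

Local Notation e i := (B`_i).
Local Notation q i := (mul (e i) (e i)).
Local Notation fst := (is_fst mul B).
Local Notation snd := (is_snd mul B).
Local Notation b := (twisted mul B).
Local Notation F := (flag b).
Local Notation c := (coordn B).
Local Notation c' := (coordn b).
Let bB : basis_of {:E} B := proj1 natB.
Let tB : basis_of {:E} b := twisted_basis K2 natB.
Let adB : adapted mul b fst := twisted_adapted K2 natB triB dim_sq.

Lemma proj2_line (x y : 'I_n) z : x != y ->
  (proj2 B x y z \in <[tnth B x - tnth B y]>%VS) = (c x z + c y z == 0).
Proof.
move=> nxy; rewrite /proj2 -!coordn_ord !(tnth_nth 0); apply/vlineP/eqP.
  have nyx : (y : nat) == x = false by apply/negbTE; rewrite eq_sym.
  case=> k eq_k; have ex := congr1 (c x) eq_k; have ey := congr1 (c y) eq_k.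
  rewrite coordnD !coordnZ coordnB !(coordn_nth bB) // !eqxx eq_sym nyx in ex.
  rewrite coordnD !coordnZ coordnB !(coordn_nth bB) // !eqxx nyx in ey.
  rewrite /= !(mulr0, mulr1, addr0, add0r) in ex ey.
  by rewrite ex ey; ring.
move=> /eqP; rewrite addr_eq0 => /eqP ->; exists (- c y z).
by rewrite scalerBr !scaleNr opprK.
Qed.

Lemma coordn_diff (x y : 'I_n) : x != y -> c x (e x - e y) + c y (e x - e y) = 0.
Proof.
move=> nxy; have nxy' : ((x : nat) == y) = false by apply/negbTE.
rewrite !coordnB !(coordn_nth bB) // !eqxx nxy' [(y : nat) == x]eq_sym nxy'.
by rewrite subr0 sub0r subrr.
Qed.

(** No vector of [F t] is paired with [b_s], because [t] starts a block and [s] is at least [t]. So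
    [b_s] annihilates [R], and its square is the only new product. With [s = t] or [s = t.+1] this
    adjoins [f] or [g] to a subalgebra below their block. *)
Lemma pair_line_subalgebra (R : {vspace E}) t s : subalgebra mul R ->
    (R <= F t)%VS -> fst t -> (t <= s)%N -> mul b`_s b`_s \in R ->
  subalgebra mul (R + <[b`_s]>)%VS.
Proof.
move=> Ralg RF ft lets sqR.
have orth w : w \in R -> mul w b`_s = 0.
  move=> /(subvP RF)/(mem_flag tB) w0; apply/eqP; rewrite -memv0.
  have [ltsn|lens] := ltnP s n; last first.
    by rewrite [b`_s]nth_default ?size_tuple // linear0r mem0v.
  apply: (bilinear_mem tB) => i j _ ltj wi; rewrite (coordn_nth tB) //.
  have [->|] := eqVneq j s; last by rewrite eqxx.
  move=> _; rewrite memv0; apply/eqP.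
  have ltit : (i < t)%N by rewrite ltnNge; apply: contraNN wi => /w0 ->.
  apply: (ad_orth adB); first exact: leq_trans ltit lets.
  apply/negP => /andP[fi /eqP s_i].
  have t_i : t = i.+1 by apply/eqP; rewrite eqn_leq ltit andbT -s_i.
  by have [_] := andP (is_fst_next K2 fi); rewrite -t_i ft.
have mulC := ad_comm adB.
move=> z1 z2 /memv_addP[w1 w1R [_ /vlineP[k1 ->] ->]] /memv_addP[w2 w2R [_ /vlineP[k2 ->] ->]].
rewrite linearDl !linearDr /= !linearZl_LR !linearZr_LR /= (orth w1) //.
rewrite (mulC b`_s w2) orth // !scaler0 addr0 add0r; apply: (subvP (addvSl _ _)).
by rewrite rpredD ?Ralg ?rpredZ.
Qed.

Lemma fst_lt_next i t : fst i -> fst t -> (i < t)%N -> (i.+1 < t)%N.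
Proof.
move=> fi ft ltit; rewrite ltn_neqAle ltit andbT; apply: contraTneq ft => <-.
by have [_ ->] := andP (is_fst_next K2 fi).
Qed.

Lemma modular_no_obstruction : modular mul -> no_obstruction mul B.
Proof.
move=> modE [U [Ualg [x [y [x' [y' [eps [S]]]]]]]] /=.
case=> ltxx' [Lxy Lxy'] eps1 disjS [defU nobs].
have [y_x _ _ _ _] := Lxy; have [y_x' _ _ _ _] := Lxy'.
have fx : fst x by apply/is_fstP; exists x, y.
have fx' : fst x' by apply/is_fstP; exists x', y'.
have nxy : x != y by rewrite -val_eqE /= y_x ltn_eqF.
have ltyx' : (y < x')%N by rewrite y_x fst_lt_next.
rewrite !proj2_line // y_x !(tnth_nth 0) y_x' in nobs.
have [e1 e2] := twisted_sq_snd K2 natB fx'.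
have s0P z : reflect (c' x z = 0) (c x z + c x.+1 z == 0).
  by rewrite -(coordn_twisted K2 natB z fx); apply: eqP.
have e_mem k : k \in S -> e k \in U.
  move=> kS; rewrite defU; apply: (subvP (addvSl _ _)); apply: memv_span.
  by apply/imageP; exists k => //; rewrite (tnth_nth 0).
have coord_e (k : nat) : k != x -> k != x.+1 -> (k < n)%N -> c' x (e k) = 0.
  move=> /negPf k1 /negPf k2 ltk; apply/s0P; rewrite !(coordn_nth bB) //.
  by rewrite [_ == k]eq_sym k1 [_ == k]eq_sym k2 addr0.
have ltx'n := ltn_ord x'; have lty'n : (x'.+1 < n)%N by rewrite -y_x' ltn_ord.
have lt2 : (x.+1 < x')%N by rewrite -y_x.
have coord_x' : c' x (e x') = 0.
  by apply: coord_e => //; rewrite gtn_eqF.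
have coord_y' : c' x (e x'.+1) = 0.
  by apply: coord_e => //; rewrite gtn_eqF // ltnS ltnW.
have vanU z : z \in U -> c' x z = 0.
  rewrite defU -span_cat; apply: coordn_span0 => w; rewrite mem_cat => /orP[].
    case/imageP=> k kS ->; rewrite (tnth_nth 0).
    have := disjointFr disjS kS; rewrite !inE => /negbT; rewrite !negb_or -!andbA.
    by case/and4P=> k1 k2 _ _; apply: coord_e => //; rewrite -y_x.
  rewrite !inE !(tnth_nth 0) => /orP[] /eqP ->.
    by apply/s0P; rewrite -y_x coordn_diff.
  by rewrite coordnD coordnZ y_x' coord_x' coord_y' mulr0 addr0.
have zU : e x' + eps *: e x'.+1 \in U.
  rewrite defU; apply: (subvP (addvSr _ _)); apply: memv_span.
  by rewrite !inE !(tnth_nth 0) y_x' eqxx orbT.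
(* Since [eps ^ 2 = 1], both signs give the same square, which is also that of [f] and of [g]. *)
have sqU : q x' + q x'.+1 \in U.
  have := Ualg _ _ zU zU; rewrite linearDl !linearDr !linearZl_LR !linearZr_LR /=.
  have -> : mul (e x') (e x'.+1) = 0 by rewrite (natural_orth natB) // ltn_eqF.
  have -> : mul (e x'.+1) (e x') = 0 by rewrite (natural_orth natB) // gtn_eqF.
  rewrite !scaler0 addr0 add0r scalerA.
  have -> : eps * eps = 1 by case: eps1 => ->; rewrite ?mulrNN mulr1.
  by rewrite scale1r.
(* Below the upper block, both [f] and [g] can be adjoined, although [U] is only known to contain
   one of them. *)
pose R := (U :&: F x')%VS.
have RF : (R <= F x')%VS := capvSr _ _.
have Ralg : subalgebra mul R.
  move=> z w /memv_capP[zU' zF] /memv_capP[wU wF]; rewrite memv_cap Ualg //.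
  exact: (ad_flag_mul_closed adB).
have sqR : q x' + q x'.+1 \in R by rewrite memv_cap sqU -e1 (ad_sq_mem adB).
have alg1 : subalgebra mul (R + <[b`_x']>)%VS.
  by apply: (@pair_line_subalgebra R x') => //; rewrite e1.
have alg2 : subalgebra mul (R + <[b`_x'.+1]>)%VS.
  by apply: (@pair_line_subalgebra R x') => //; rewrite e2.
have algW : subalgebra mul (F x'.+1).
  by move=> z w zF wF; apply: (ad_flag_mul_closed adB).
have RF1 : (R <= F x'.+1)%VS := subv_trans RF (flagS b (leqnSn x')).
have sub1 : (R + <[b`_x']> <= F x'.+1)%VS.
  by rewrite subv_add RF1 -memvE (nth_flag tB).
have [_ modl] := modE _ _ _ alg1 alg2 algW sub1 (mul b`_x' b`_x'.+1).
have : in_gen mul [predU (R + <[b`_x']>)%VS & ((R + <[b`_x'.+1]>) :&: F x'.+1)%VS]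
         (mul b`_x' b`_x'.+1).
  apply: modl; split; last exact: (ad_pr_mem adB).
  move=> A Aalg sA; apply: Aalg; apply: sA; rewrite !inE.
    by rewrite (subvP (addvSr _ _) _ (memv_line _)).
  by rewrite (subvP (addvSr R _) _ (memv_line b`_x'.+1)) orbT.
move/(_ _ alg1); have sub2 :
    {subset [predU (R + <[b`_x']>)%VS & ((R + <[b`_x'.+1]>) :&: F x'.+1)%VS]
       <= (R + <[b`_x']>)%VS}.
  move=> z /orP[//|/memv_capP[/memv_addP[w wR [_ /vlineP[k ->] ->]] wF]].
  suff -> : k = 0 by rewrite scale0r addr0 (subvP (addvSl _ _)).
  move/(mem_flag tB)/(_ x'.+1 (leqnn _)): wF; rewrite coordnD coordnZ.
  have /(mem_flag tB) -> // := subvP RF1 _ wR.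
  by rewrite (coordn_nth tB) // eqxx mulr1 add0r.
(* Hence [f g] lies in [R + <f>], where the [f]-coordinate of the lower block is zero. *)
move/(_ sub2)/memv_addP => [w /memv_capP[/vanU w0 _] [_ /vlineP[k ->]]].
move/(congr1 (c' x)); rewrite coordnD w0 coordnZ (twisted_fst K2 fx') coordnD.
rewrite coord_x' coord_y' addr0 mulr0 addr0 -(twisted_fst K2 fx').
rewrite (twisted_pr K2 natB fx') => /s0P; have /s0P := vanU _ sqU.
rewrite !coordnB !coordnD => /eqP s1 /eqP s2.
(* The sum and the difference of the two squares satisfy the equation of the lower block; so does
   each of them, 2 being invertible. *)
have s3 : c x (q x') + c x.+1 (q x') = 0.
  apply/eqP; rewrite -(mulrI_eq0 _ (mulfI K2)); apply/eqP.
  rewrite -[RHS](addr0 0) -{1}s1 -s2; ring.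
have s4 : c x (q x'.+1) + c x.+1 (q x'.+1) = 0.
  rewrite -[RHS]s1 -[LHS]add0r -{1}s3; ring.
by case: nobs; rewrite ?s3 ?s4 eqxx.
Qed.

Lemma no_obstruction_modular : no_obstruction mul B -> modular mul.
Proof.
move=> noobs; apply: (ad_modular adB K2) => i t fi ft ltit closed sq0.
apply/eqP/negPn/negP => pr_n0; apply: noobs.
have [x [y [x_i Lxy]]] := is_fstP _ _ _ fi; have [y_x _ _ _ _] := Lxy.
have [x' [y' [x_t Lxy']]] := is_fstP _ _ _ ft; have [y_x' _ _ _ _] := Lxy'.
rewrite -{}x_i in fi ltit closed sq0 pr_n0; rewrite -{}x_t in ft ltit closed sq0 pr_n0.
have nxy : x != y by rewrite -val_eqE /= y_x ltn_eqF.
have ltyx' : (y < x')%N by rewrite y_x fst_lt_next.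
have s0P z : reflect (c' x z = 0) (c x z + c x.+1 z == 0).
  by rewrite -(coordn_twisted K2 natB z fi); apply: eqP.
(* [U0] is the kernel of [c' x] in [F x'], written in the natural basis with the shape required of
   an obstruction. *)
pose S := [set k : 'I_n | [&& (k < x')%N, k != x & k != y]].
pose U0 := (span_of B S + <[e x - e y]>)%VS.
have [lty'n nfy'] := andP (is_fst_next K2 ft).
have FE : F x' = flag B x' := flag_twisted K2 natB (is_fst_nsnd K2 ft).
have U0F : (U0 <= F x')%VS.
  rewrite FE subv_add -memvE rpredB ?andbT ?(nth_flag bB) //.
  apply/span_subvP => z /imageP[k]; rewrite inE => /and3P[ltk _ _] ->.
  by rewrite (tnth_nth 0) (nth_flag bB).
have U0c z : z \in U0 -> c' x z = 0.
  rewrite /U0 -span_seq1 -span_cat; apply: coordn_span0 => w; rewrite mem_cat => /orP[].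
    case/imageP=> k; rewrite inE => /and3P[_ k1 k2] ->; apply/s0P.
    rewrite (tnth_nth 0) -y_x !(coordn_nth bB) //.
    have -> : ((x : nat) == k) = false by rewrite eq_sym; apply/negbTE.
    have -> : ((y : nat) == k) = false by rewrite eq_sym; apply/negbTE.
    by rewrite addr0.
  rewrite inE => /eqP ->; by apply/s0P; rewrite -y_x coordn_diff.
have U0P z : z \in F x' -> c' x z = 0 -> z \in U0.
  rewrite FE => /(mem_flag bB) zF /s0P; rewrite -y_x addr_eq0 => /eqP zxy.
  rewrite (coordn_sum bB z) (bigD1 x) //= (bigD1 y) 1?eq_sym //= addrA addrC.
  apply: memv_add; last first.
    by apply/vlineP; exists (c x z); rewrite scalerBr zxy !scaleNr opprK.
  apply: memv_suml => k /andP[k1 k2].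
  have [ltk|/zF ->] := ltnP k x'; last by rewrite scale0r mem0v.
  apply/memvZ/memv_span/imageP; exists k; last by rewrite (tnth_nth 0).
  by rewrite inE ltk k1.
have U0alg : subalgebra mul U0.
  move=> z w zU wU; apply: U0P; last by apply: closed; rewrite ?U0c ?(subvP U0F).
  by apply: (ad_flag_mul_closed adB); apply: (subvP U0F).
have [e1 e2] := twisted_sq_snd K2 natB ft.
have sqU0 : q x' + q x'.+1 \in U0.
  by rewrite -e1; apply: U0P => //; apply: (ad_sq_mem adB).
(* The vector adjoined is [g = e_j - e_{j+1}], which corresponds to [eps = -1]. *)
exists (U0 + <[b`_x'.+1]>)%VS; split.
  by apply: (@pair_line_subalgebra U0 x') => //; rewrite e2.
exists x, y, x', y', (-1), S; split=> //; first by right.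
  rewrite disjoint_subset; apply/subsetP => k; rewrite !inE => /and3P[ltk k1 k2].
  by rewrite !negb_or k1 k2 -!val_eqE /= y_x' !ltn_eqF // ltnS ltnW.
split.
  rewrite /U0 span_cons span_seq1 !(tnth_nth 0) addvA y_x'.
  by rewrite (twisted_snd K2 ft) scaleN1r.
rewrite !proj2_line // y_x !(tnth_nth 0) y_x'; apply/orP; rewrite -negb_and.
apply: contra pr_n0 => /andP[/eqP s1 /eqP s2]; apply/eqP/s0P.
rewrite (twisted_pr K2 natB ft) !coordnB; apply/eqP.
by rewrite addrACA -opprD s1 s2 subrr.
Qed.

End Obstructions.

(** * The derived series *)

Section SpanOf.

Variables (K : fieldType) (E : vectType K) (mul : {bilinear E -> E -> E}).
Variables (n : nat) (B : n.-tuple E).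
Hypothesis natB : natural_basis mul B.
Let bB : basis_of {:E} B := proj1 natB.

Lemma mem_span_of (S : {set 'I_n}) x :
  reflect (forall i, i \notin S -> coordn B i x = 0) (x \in span_of B S).
Proof.
apply: (iffP idP) => [xS i niS | x0].
  apply: coordn_span0 xS => z /imageP[j jS ->].
  rewrite (tnth_nth 0) (coordn_nth bB) // (_ : (i : nat) == j = false) //.
  by apply: contraNF niS => /eqP/val_inj ->.
rewrite (coordn_sum bB x); apply: memv_suml => i _.
have [iS|/x0 ->] := boolP (i \in S); last by rewrite scale0r mem0v.
by apply/memvZ/memv_span/imageP; exists i; rewrite ?(tnth_nth 0).
Qed.

Lemma nth_span_of (S : {set 'I_n}) (i : 'I_n) : (B`_i \in span_of B S) = (i \in S).
Proof.
apply/idP/idP => [/mem_span_of eS|iS]; last first.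
  by apply: memv_span; apply/imageP; exists i; rewrite ?(tnth_nth 0).
apply: contraT => /eS; rewrite (coordn_nth bB) // eqxx => /eqP.
by rewrite oner_eq0.
Qed.

Lemma span_of_subP (S : {set 'I_n}) (W : {vspace E}) :
  reflect (forall i : 'I_n, i \in S -> B`_i \in W) (span_of B S <= W)%VS.
Proof.
apply: (iffP idP) => [SW i iS | eW]; first by apply: (subvP SW); rewrite nth_span_of.
by apply/span_subvP => z /imageP[i iS ->]; rewrite (tnth_nth 0) eW.
Qed.

Lemma span_of_mul (S : {set 'I_n}) (W : {vspace E}) x y :
    (forall i : 'I_n, i \in S -> mul B`_i B`_i \in W) -> x \in span_of B S ->
  mul x y \in W.
Proof.
move=> sqW /mem_span_of x0; rewrite (natural_mulE _ _ natB); apply: memv_suml => i _.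
have [iS|/x0 ->] := boolP (i \in S); last by rewrite mul0r scale0r mem0v.
by rewrite rpredZ // sqW.
Qed.

Lemma span_of_orth (S : {set 'I_n}) (i : 'I_n) x : x \in span_of B S ->
  i \notin S -> mul B`_i x = 0.
Proof.
move=> /mem_span_of x0 niS; rewrite (natural_mulE _ _ natB) big1 // => j _.
rewrite (coordn_nth bB) //; case: eqVneq => [/val_inj ->|_]; last by rewrite mul0r scale0r.
by rewrite x0 // mulr0 scale0r.
Qed.

End SpanOf.

Section DerivedSeries.

Variables (K : fieldType) (E : vectType K) (mul : {bilinear E -> E -> E}).
Hypothesis max_index : max_solvability_index mul.
Local Notation n := (\dim {:E}).
Local Notation D := (derived mul).

Lemma derived1 : D 1 = {:E}%VS.
Proof. by []. Qed.

Lemma derivedS k : (0 < k)%N -> D k.+1 = mulv mul (D k) (D k).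
Proof. by case: k. Qed.

Lemma derived_last : D n.+1 = 0%VS.
Proof. by have [] := max_index. Qed.

Lemma derived_mul k x y : (0 < k)%N -> x \in D k -> y \in D k -> mul x y \in D k.+1.
Proof. by move=> k_gt0 xD yD; rewrite derivedS // mem_mulv. Qed.

Lemma derived_sub k : (0 < k)%N -> (D k.+1 <= D k)%VS.
Proof.
elim: k => // -[|k] IHk _; first by rewrite derived1 subvf.
rewrite [D k.+3]derivedS //; apply/mulv_subP => x y xD yD.
by apply: derived_mul => //; apply: (subvP (IHk isT)).
Qed.

Lemma derived_le j k : (0 < j)%N -> (j <= k)%N -> (D k <= D j)%VS.
Proof.
move=> j_gt0 /subnKC <-; elim: (k - j)%N => [|m IHm]; first by rewrite addn0.
by rewrite addnS (subv_trans _ IHm) // derived_sub // addn_gt0 j_gt0.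
Qed.

Lemma derived_subalgebra k : (0 < k)%N -> subalgebra mul (D k).
Proof.
by move=> k_gt0 x y xD yD; apply: (subvP (derived_sub k_gt0)); apply: derived_mul.
Qed.

(** Two equal consecutive terms would make the series constant from there on, hence zero before the
    index of solvability. *)
Lemma derived_strict k : (0 < k <= n)%N -> ~~ (D k <= D k.+1)%VS.
Proof.
case/andP=> k_gt0 lekn; apply/negP => sub; have [_ Dn0 Dne] := max_index.
have eqD m : D (k + m) = D k.
  elim: m => [|m IHm]; first by rewrite addn0.
  rewrite addnS derivedS ?addn_gt0 ?k_gt0 // IHm -derivedS //.
  by apply/eqP; rewrite eqEsubv sub derived_sub.
apply: (Dne k); first by rewrite k_gt0 ltnS.
by rewrite -(eqD (n.+1 - k)%N) subnKC // ltnW.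
Qed.

(** The series decreases strictly from dimension [n] to 0 in [n] steps, so every step is exactly
    one; [upper] counts from the top and [lower] from the bottom. *)
Lemma dim_derived k : (0 < k <= n.+1)%N -> \dim (D k) = (n.+1 - k)%N.
Proof.
have ltD j : (0 < j <= n)%N -> (\dim (D j.+1) < \dim (D j))%N.
  move=> jn; rewrite ltn_neqAle dimvS ?andbT; last first.
    by apply: derived_sub; case/andP: jn.
  apply: contra (derived_strict jn) => eq_dim.
  have [j_gt0 _] := andP jn.
  have := eqEdim (D j.+1) (D j); rewrite derived_sub // (eqP eq_dim) leqnn => /eqP ->.
  exact: subvv.
have upper j : (j <= n)%N -> (\dim (D j.+1) <= n - j)%N.
  elim: j => [|j IHj] ltj; first by rewrite derived1 subn0.
  by have := ltD j.+1; have := IHj (ltnW ltj); lia.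
have lower j : (j <= n)%N -> (j <= \dim (D (n.+1 - j)))%N.
  elim: j => // j IHj ltj; have := ltD (n.+1 - j.+1)%N; have := IHj (ltnW ltj).
  have -> : (n.+1 - j.+1).+1 = (n.+1 - j)%N by lia.
  by lia.
case/andP=> k_gt0 lek; have := lower (n.+1 - k)%N; have := upper k.-1.
rewrite prednK // subKn //; lia.
Qed.

Lemma dim_square : (n.-1 <= \dim (mulv mul {:E} {:E}))%N.
Proof.
case: (posnP n) => [-> //|n_gt0].
by rewrite -[mulv _ _ _]/(D 2) dim_derived; lia.
Qed.

Lemma derived_hyperplane k (X : {vspace E}) v : (0 < k <= n)%N ->
  (X <= D k.+1)%VS -> (D k <= X + <[v]>)%VS -> X = D k.+1.
Proof.
move=> kn XD DX; apply/eqP; rewrite eqEdim XD dim_derived /=; last by case/andP: kn.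
have := dimvS DX; rewrite dim_derived; last by lia.
have [le_add _] := dimv_add_leqif X <[v]>.
by have := leq_b1 (v != 0); rewrite -dim_vline; lia.
Qed.

Lemma derived_add k v : (0 < k <= n)%N -> v \in D k -> v \notin D k.+1 ->
  (D k.+1 + <[v]>)%VS = D k.
Proof.
move=> kn vD nvD; have [k_gt0 lek] := andP kn.
have sub : (D k.+1 + <[v]> <= D k)%VS by rewrite subv_add derived_sub // -memvE.
apply/eqP; rewrite eqEdim sub dim_derived; last by lia.
have : (\dim (D k.+1) < \dim (D k.+1 + <[v]>))%N.
  rewrite ltn_neqAle dimvS ?addvSl // andbT; apply: contra nvD => eq_dim.
  have := eqEdim (D k.+1) (D k.+1 + <[v]>); rewrite addvSl -(eqP eq_dim) leqnn.
  by move/eqP=> ->; apply: (subvP (addvSr _ _)); apply: memv_line.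
by rewrite dim_derived; lia.
Qed.

Section Support.

Variable B : n.-tuple E.
Hypothesis natB : natural_basis mul B.
Let bB : basis_of {:E} B := proj1 natB.
Local Notation e i := (B`_i).

Definition spanned k := [exists S : {set 'I_n}, D k == span_of B S].

Lemma spannedP k : reflect (exists S, D k = span_of B S) (spanned k).
Proof. by apply: (iffP existsP) => -[S /eqP]; exists S => //; apply/eqP. Qed.

Lemma spanned1 : spanned 1.
Proof.
apply/spannedP; exists setT; apply/eqP; rewrite eqEsubv subvf andbT.
by apply/subvP => x _; apply/(mem_span_of natB) => i; rewrite inE.
Qed.

Lemma spanned_last : spanned n.+1.
Proof.
apply/spannedP; exists set0; rewrite derived_last; apply/eqP.
by rewrite eq_sym -subv0; apply/(span_of_subP natB) => i; rewrite inE.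
Qed.

Lemma nspanned_lt k : (0 < k <= n.+1)%N -> ~~ spanned k -> (0 < k <= n)%N.
Proof.
case/andP=> -> /=; rewrite leq_eqVlt => /predU1P[->|//].
by rewrite spanned_last.
Qed.

Lemma derived_sq_sub k (S : {set 'I_n}) (W : {vspace E}) : (0 < k)%N ->
    D k = span_of B S -> (forall i : 'I_n, i \in S -> mul (e i) (e i) \in W) ->
  (D k.+1 <= W)%VS.
Proof.
move=> k_gt0 defD sqW; rewrite derivedS //; apply/mulv_subP => x y xD _.
by rewrite defD in xD; apply: (span_of_mul natB) xD.
Qed.

(* If two coordinates besides [s] occurred in the equation of the hyperplane
   [D k.+1] of [D k], the product of two of its elements would be a multiple of
   [e_s ^ 2], and [D k.+2] would contain all the squares. *)
Lemma derived_support k (S : {set 'I_n}) : (0 < k <= n)%N ->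
    D k = span_of B S -> ~~ spanned k.+1 ->
  exists (s l : 'I_n) (a : K), [/\ s \in S, l \in S, s != l, a != 0 &
    D k.+1 = (span_of B (S :\ s :\ l) + <[e s + a *: e l]>)%VS].
Proof.
move=> kn defD nsp; have [k_gt0 lek] := andP kn.
have kn1 : (0 < k.+1 <= n)%N by apply: nspanned_lt nsp; rewrite ltnS.
have [s sS nsD] : exists2 s : 'I_n, s \in S & e s \notin D k.+1.
  have := derived_strict kn; rewrite {1}defD => /subvPn[x xS nxD].
  have [/existsP[s /andP[sS nsD]]|] := boolP [exists s : 'I_n, (s \in S) && (e s \notin D k.+1)].
    by exists s.
  rewrite negb_exists => /forallP noS; case/negP: nxD; apply: subvP xS.
  apply/(span_of_subP natB) => i iS; have := noS i.
  by rewrite iS negbK.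
have eD (i : 'I_n) : i \in S -> e i \in D k by rewrite defD (nth_span_of natB).
(* The [a i] are the values at the [e i] of the linear form on [D k] with kernel [D k.+1] and value
   1 at [e s]. *)
have [a aP] : exists a : 'I_n -> K, forall i, i \in S -> e i - a i *: e s \in D k.+1.
  pose Q (i : 'I_n) (c : K) := i \in S -> e i - c *: e s \in D k.+1.
  apply: (@fin_all_exists _ (fun _ => K) Q) => i; rewrite /Q; have [iS|niS] := boolP (i \in S); last by exists 0.
  have := eD i iS; rewrite -(derived_add kn (eD s sS) nsD).
  case/memv_addP=> u uD [_ /vlineP[c ->] ->]; exists c => _.
  by rewrite addrK.
have memS (X : {vspace E}) : (forall i : 'I_n, i \in S -> i != s -> e i \in X + <[e s]>)%VS ->
    (D k <= X + <[e s]>)%VS.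
  move=> eX; rewrite defD; apply/(span_of_subP natB) => i iS.
  have [->|nis] := eqVneq i s; last exact: eX.
  by apply: (subvP (addvSr _ _)); apply: memv_line.
have [/existsP[l /and3P[lS nls al]]|] := boolP [exists l, [&& l \in S, l != s & a l != 0]];
    last first.
  rewrite negb_exists => /forallP a0; case/negP: nsp; apply/spannedP.
  exists (S :\ s); apply/esym/(derived_hyperplane (v := e s)) => //.
    apply/(span_of_subP natB) => i; rewrite !inE => /andP[nis iS].
    have := a0 i; rewrite iS nis negbK => /eqP ai.
    by have := aP i iS; rewrite ai scale0r subr0.
  apply: memS => i iS nis; apply: (subvP (addvSl _ _)).
  by rewrite (nth_span_of natB) !inE nis.
have nat0 (i j : 'I_n) : i != j -> mul (e i) (e j) = 0 by move=> nij; apply: (natural_orth natB).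
have a0 m : m \in S -> m != s -> m != l -> a m = 0.
  move=> mS nms nml; apply/eqP; case: eqVneq => // am.
  have sqs : mul (e s) (e s) \in D k.+2.
    have : mul (e l - a l *: e s) (e m - a m *: e s) \in D k.+2 by rewrite derived_mul ?aP.
    rewrite linearBl !linearBr /= !linearZl_LR !linearZr_LR /=.
    rewrite (nat0 l m) 1?eq_sym // (nat0 l s) // (nat0 s m) 1?eq_sym //.
    rewrite !scaler0 !subr0 sub0r opprB subr0 scalerA => h.
    by rewrite -(scalerK (mulf_neq0 al am) (mul _ _)) rpredZ.
  case/negP: (derived_strict kn1); apply: derived_sq_sub defD _ => // i iS.
  have [->//|nis] := eqVneq i s.
  have : mul (e i - a i *: e s) (e i - a i *: e s) \in D k.+2 by rewrite derived_mul ?aP.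
  rewrite linearBl !linearBr /= !linearZl_LR !linearZr_LR /=.
  rewrite (nat0 i s) // (nat0 s i) 1?eq_sym // !scaler0 subr0 sub0r opprK.
  by rewrite rpredDr // !rpredZ.
(* This coefficient puts [e s + _ *: e l] in the kernel of the linear form. *)
exists s, l, (- (a l)^-1); split=> //; first by rewrite eq_sym.
  by rewrite oppr_eq0 invr_eq0.
apply/esym/(derived_hyperplane (v := e s)) => //.
  rewrite subv_add -memvE; apply/andP; split.
    apply/(span_of_subP natB) => i; rewrite !inE => /and3P[nil nis iS].
    by have := aP i iS; rewrite a0 // scale0r subr0.
  have -> : e s + - (a l)^-1 *: e l = - (a l)^-1 *: (e l - a l *: e s).
    by rewrite scalerBr scaleNr scalerA mulNr mulVf // scaleN1r opprK addrC.
  by rewrite rpredZ // aP.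
apply: memS => i iS nis; have [->|nil] := eqVneq i l; last first.
  apply: (subvP (addvSl _ _)); apply: (subvP (addvSl _ _)).
  by rewrite (nth_span_of natB) !inE nil nis.
set g := e s + _.
have -> : e l = - a l *: g + a l *: e s.
  rewrite /g scalerDr scalerA mulrNN mulfV // scale1r scaleNr.
  by rewrite addrAC addNr add0r.
apply: memv_add; rewrite rpredZ ?memv_line //.
by apply: (subvP (addvSr _ _)); apply: memv_line.
Qed.

End Support.

End DerivedSeries.

(** * Derived series of a modular algebra *)

Section ModularDerived.

Variables (K : fieldType) (E : vectType K) (mul : {bilinear E -> E -> E}).
Hypotheses (K2 : 2%:R != 0 :> K) (max_index : max_solvability_index mul).
Local Notation n := (\dim {:E}).
Local Notation D := (derived mul).
Variable B : n.-tuple E.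
Hypothesis natB : natural_basis mul B.
Local Notation e i := (B`_i).
Local Notation spanned := (spanned mul B).

Lemma derived_pair_notin k (S : {set 'I_n}) (s l : 'I_n) a : (0 < k <= n)%N ->
    D k = span_of B S -> a != 0 ->
    D k.+1 = (span_of B (S :\ s :\ l) + <[e s + a *: e l]>)%VS ->
  e s \notin D k.+1 /\ e l \notin D k.+1.
Proof.
move=> kn defD an0 defD1.
have gD : e s + a *: e l \in D k.+1.
  by rewrite defD1; apply: (subvP (addvSr _ _)); apply: memv_line.
have both : e s \in D k.+1 -> e l \in D k.+1 -> False.
  move=> sD lD; case/negP: (derived_strict max_index kn); rewrite {1}defD.
  apply/(span_of_subP natB) => i iS.
  have [->//|nis] := eqVneq i s; have [->//|nil] := eqVneq i l.
  rewrite defD1; apply: (subvP (addvSl _ _)).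
  by rewrite (nth_span_of natB) !inE nil nis.
split; apply/negP => mD; apply: both => //.
  by move: gD; rewrite rpredDl // => /(rpredZ a^-1); rewrite scalerK.
by move: gD; rewrite rpredDr // rpredZ.
Qed.

(* With [x = e_s + a e_l + w] in the last term [D j] not contained in [O], and
   [v = e_s - a e_l + w], the modular law fails for [D j], [(D j :&: O) + <v>] and
   [D k.+1]: [v x] lies in the subalgebra generated by [x] and [v], but not in
   [D k.+2]. *)
Lemma modular_spanned_step k : modular mul -> (0 < k <= n)%N ->
  spanned k -> ~~ spanned k.+1 -> spanned k.+2.
Proof.
move=> modE kn /spannedP[S defD] nsp; case: (boolP (spanned k.+2)) => // nsp2; exfalso.
have [k_gt0 lek] := andP kn.
have kn1 : (0 < k.+1 <= n)%N by apply: (nspanned_lt max_index natB) nsp; rewrite ltnS.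
have kn2 : (0 < k.+2 <= n)%N by apply: (nspanned_lt max_index natB) nsp2; rewrite ltnS.
have [[_ lek1] [_ lek2]] := (andP kn1, andP kn2).
have [s [l [a [sS lS nsl an0 defD1]]]] := derived_support max_index natB kn defD nsp.
have [nsD nlD] := derived_pair_notin kn defD an0 defD1.
set O := span_of B _ in defD1; set g := e s + a *: e l in defD1.
have mulC x y : mul x y = mul y x := natural_mulC x y natB.
have esl : mul (e s) (e l) = 0 by apply: (natural_orth natB).
have sO x : x \in O -> mul (e s) x = 0.
  by move/(span_of_orth natB); apply; rewrite !inE eqxx andbF.
have lO x : x \in O -> mul (e l) x = 0.
  by move/(span_of_orth natB); apply; rewrite !inE eqxx.
have OD1 : (O <= D k.+1)%VS by rewrite defD1 addvSl.
have gD1 : g \in D k.+1 by rewrite defD1 (subvP (addvSr _ _)) ?memv_line.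
(* [O] is a proper subspace of [D k.+1], so by dimension an inclusion would be an equality and
   [D k.+2] would be spanned by part of [B]. *)
have D2O : ~~ (D k.+2 <= O)%VS.
  apply: contra nsp2 => sub; apply/spannedP; exists (S :\ s :\ l).
  apply/eqP; rewrite eqEdim sub (dim_derived max_index) //=.
  have OD : O != D k.+1.
    by apply: contra nsp => /eqP defO; apply/spannedP; exists (S :\ s :\ l).
  have := eqEdim O (D k.+1); rewrite OD1 (negPf OD) /= (dim_derived max_index) //.
  by move/esym/negbT; rewrite -ltnNge !subSS -(subnSK lek1).
(* The predecessor of the least such index takes the name [j] below; all products of elements of
   [D j] then fall into [O]. *)
have exj : exists j, (k.+2 <= j)%N && (D j <= O)%VS.
  by exists n.+1; rewrite (derived_last max_index) sub0v andbT ltnW.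
case: (ex_minnP exj) => j /andP[lekj DjO] jmin.
have ltkj : (k.+2 < j)%N.
  by rewrite ltn_neqAle lekj andbT; apply: contraNneq D2O => ->.
case: j ltkj lekj DjO jmin => // j ltkj lekj DjO jmin.
have nDjO : ~~ (D j <= O)%VS.
  by apply/negP => DjO'; have := jmin j; rewrite DjO' andbT ltnn => /(_ ltkj).
rewrite ltnS in ltkj; have j_gt0 : (0 < j)%N by apply: leq_trans ltkj.
have DjD2 : (D j <= D k.+2)%VS by apply: derived_le.
have D21 : (D k.+2 <= D k.+1)%VS by apply: derived_sub.
have D10 : (D k.+1 <= D k)%VS by apply: derived_sub.
have [x xD [w wO def_x]] : exists2 x, x \in D j & exists2 w, w \in O & x = g + w.
  case/subvPn: nDjO => u uD nuO; have := subvP (subv_trans DjD2 D21) u uD.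
  rewrite defD1 => /memv_addP[w wO [_ /vlineP[c ->] def_u]].
  have cn0 : c != 0.
    by apply: contraNneq nuO => c0; rewrite def_u c0 scale0r addr0.
  exists (c^-1 *: u); first by rewrite rpredZ.
  exists (c^-1 *: w); first by rewrite rpredZ.
  by rewrite def_u scalerDr scalerK // addrC.
(* [v] is [x] with the sign of its [e l] term changed. As [e l] is orthogonal to [e s] and to [O],
   this preserves the square, but changes the product with [x] by a nonzero multiple of the square
   of [e l]. *)
pose v := x - (2%:R * a) *: e l; pose R := (D j :&: O)%VS.
have an2 : 2%:R * a != 0 by rewrite mulf_neq0.
have lx : mul (e l) x = a *: mul (e l) (e l).
  rewrite def_x /g !linearDr /= (lO w) // linearZr_LR /= (mulC _ (e s)) esl.
  by rewrite add0r addr0.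
have vx : mul v x = mul x x - (2%:R * a * a) *: mul (e l) (e l).
  by rewrite /v linearBl linearZl_LR /= lx scalerA.
have vv : mul v v = mul x x.
  rewrite {2}/v linearBr linearZr_LR /= vx (mulC v) /v linearBr linearZr_LR /= lx.
  rewrite -addrA -opprD -[X in _ = X]subr0; congr (_ - _).
  rewrite scalerBr !scalerA addrA -scalerDl -scalerBl.
  by rewrite (_ : _ - _ = 0) ?scale0r //; ring.
have Rmul y z : y \in D j -> z \in D j -> mul y z \in R.
  move=> yD zD; have := derived_mul j_gt0 yD zD => yzD.
  by rewrite memv_cap (subvP DjO) // (subvP (derived_sub mul j_gt0)).
have Rv r : r \in R -> mul r v = mul r x.
  case/memv_capP=> _ rO; rewrite /v linearBr linearZr_LR /= (mulC r (e l)) lO //.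
  by rewrite scaler0 subr0.
have Ralg : subalgebra mul R by move=> y z /memv_capP[yD _] /memv_capP[zD _]; apply: Rmul.
have Valg : subalgebra mul (R + <[v]>)%VS.
  move=> _ _ /memv_addP[r rR [_ /vlineP[c ->] ->]] /memv_addP[r' r'R [_ /vlineP[c' ->] ->]].
  have [[rD _] [r'D _]] := (memv_capP rR, memv_capP r'R).
  apply: (subvP (addvSl _ _)); rewrite linearDl !linearDr /=.
  rewrite !linearZl_LR !linearZr_LR /= (mulC v r') vv !Rv //.
  by rewrite !rpredD ?rpredZ ?Rmul.
have Ualg : subalgebra mul (D j) by apply: derived_subalgebra.
have Walg : subalgebra mul (D k.+1) by apply: derived_subalgebra.
have RU : (R <= D j)%VS := capvSl _ _.
have UW : (D j <= D k.+1)%VS := subv_trans DjD2 D21.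
have [_ modl] := modE _ _ _ Ualg Valg Walg UW (mul v x).
have vD0 : v \in D k.
  by rewrite rpredB ?rpredZ ?(subvP (subv_trans UW D10) x) // defD (nth_span_of natB).
have vxU : mul v x \in D j.
  apply: modl; last 2 first.
  - exact: Ualg.
  (* [v] is outside [D k.+1], since [x] is inside and [e l] is not; so the intersection with [W]
     adds nothing to [D j]. *)
  - move=> y /orP[//|/memv_capP[/memv_addP[r rR [_ /vlineP[c ->] ->]] yW]].
    have rU := subvP RU r rR; move: yW; rewrite rpredDl ?(subvP UW r) // => cv.
    have [->|cn0] := eqVneq c 0; first by rewrite scale0r addr0.
    case/negP: nlD; have : v \in D k.+1 by rewrite -(scalerK cn0 v) rpredZ.
    rewrite /v rpredDl ?(subvP UW x) // rpredN => lD.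
    by rewrite -(scalerK an2 (e l)) rpredZ.
  split; last by apply: derived_mul => //; apply: (subvP (subv_trans UW D10)).
  move=> A Aalg sA; apply: Aalg; apply: sA; rewrite !inE ?xD //.
  by rewrite (subvP (addvSr R _) _ (memv_line v)) orbT.
have sq2 y : y \in D k.+1 -> mul y y \in D k.+2 by move=> yD; apply: derived_mul.
(* From [v x] one gets the square of [e l], then from [g ^ 2] that of [e s]. All the squares of
   basis vectors of [D k] are then in [D k.+2], which cannot contain [D k.+1]. *)
have ll : mul (e l) (e l) \in D k.+2.
  have x2 := sq2 x (subvP UW x xD).
  have := subvP DjD2 _ vxU; rewrite vx rpredDl // rpredN => h.
  by rewrite -(scalerK (mulf_neq0 an2 an0) (mul _ _)) rpredZ.
have ss : mul (e s) (e s) \in D k.+2.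
  have := sq2 g gD1; rewrite /g linearDl !linearDr /= !linearZl_LR !linearZr_LR /=.
  rewrite (mulC (e l) (e s)) esl !scaler0 addr0 add0r rpredDr //.
  by rewrite !rpredZ.
case/negP: (derived_strict max_index kn1); apply: derived_sq_sub defD _ => // i iS.
have [->//|nis] := eqVneq i s; have [->//|nil] := eqVneq i l.
by apply: sq2; apply: (subvP OD1); rewrite (nth_span_of natB) !inE nil nis.
Qed.

Lemma modular_spanned : modular mul -> forall k, (0 < k <= n)%N ->
  spanned k || spanned k.+1.
Proof.
move=> modE; elim=> // -[|k] IHk kn; first by rewrite (spanned1 natB).
case/orP: (IHk ltac:(lia)) => [sp|->//].
case: (boolP (spanned k.+2)) => //= nsp.
by apply: (@modular_spanned_step k.+1) => //; lia.
Qed.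

End ModularDerived.

(** * Independence of the natural basis *)

Section BasicIdeals.

Variables (K : fieldType) (E : vectType K) (mul : {bilinear E -> E -> E}).
Hypothesis max_index : max_solvability_index mul.
Local Notation n := (\dim {:E}).
Local Notation D := (derived mul).
Variable B : n.-tuple E.
Hypothesis natB : natural_basis mul B.
Let bB : basis_of {:E} B := proj1 natB.
Local Notation e i := (B`_i).
Local Notation c := (coordn B).

(* The squares [e_i ^ 2] span a space of dimension [n - 1], so they satisfy a
   single linear relation, the one given by [x * x = 0]. *)
Lemma annihilating_pair (x u v : E) : x != 0 -> mul x x = 0 -> mul u v = 0 ->
  exists a, forall i : 'I_n, c i u * c i v = a * (c i x * c i x).
Proof.
move=> xn0 xx0 uv0; have [i0 xi0] : exists i0 : 'I_n, c i0 x != 0.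
  apply/existsP; apply: contraNT xn0; rewrite negb_exists => /forallP x0.
  rewrite (coordn_sum bB x) big1 // => i _.
  by have := x0 i; rewrite negbK => /eqP ->; rewrite scale0r.
pose a := c i0 u * c i0 v / (c i0 x * c i0 x); exists a.
have xx_n0 : c i0 x * c i0 x != 0 by rewrite mulf_neq0.
pose y (i : 'I_n) := c i u * c i v - a * (c i x * c i x).
suff y0 i : y i = 0 by move=> i; apply/eqP; rewrite -subr_eq0; apply/eqP/y0.
have yi0 : y i0 = 0 by rewrite /y /a divfK // subrr.
have sum_x : \sum_(i < n) (c i x * c i x) *: mul (e i) (e i) = 0.
  by rewrite -(natural_mulE _ _ natB).
have sum_y : \sum_(i < n) y i *: mul (e i) (e i) = 0.
  under eq_bigr do rewrite /y scalerBl -[(a * _) *: _]scalerA.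
  by rewrite sumrB -scaler_sumr sum_x -(natural_mulE _ _ natB) uv0 scaler0 subr0.
apply/eqP/negPn/negP => yi; have nii0 : i != i0 by apply: contraNneq yi => ->; rewrite yi0.
(* A second, independent relation would eliminate the squares of both [e i0] and [e i], leaving
   [n - 2] generators for a space of dimension at least [n - 1]. *)
pose T := <<[seq mul (e j) (e j) | j : 'I_n in ~: [set i0; i]]>>%VS.
have memT (j : 'I_n) : j != i0 -> j != i -> mul (e j) (e j) \in T.
  move=> j0 j1; apply/memv_span/imageP; exists j => //.
  by rewrite !inE negb_or j0 j1.
have iT : mul (e i) (e i) \in T.
  rewrite -(scalerK yi (mul _ _)) rpredZ //; move/eqP: sum_y.
  rewrite (bigD1 i) //= addr_eq0 => /eqP ->; rewrite rpredN memv_suml // => j ji.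
  have [->|j0] := eqVneq j i0; first by rewrite yi0 scale0r mem0v.
  by rewrite rpredZ // memT.
have i0T : mul (e i0) (e i0) \in T.
  rewrite -(scalerK xx_n0 (mul _ _)) rpredZ //; move/eqP: sum_x.
  rewrite (bigD1 i0) //= addr_eq0 => /eqP ->; rewrite rpredN memv_suml // => j j0.
  by have [->|ji] := eqVneq j i; rewrite rpredZ // memT.
have sub : (mulv mul {:E} {:E} <= T)%VS.
  apply/mulv_subP => z w _ _; rewrite (natural_mulE _ _ natB) memv_suml // => j _.
  rewrite rpredZ //; have [->//|j0] := eqVneq j i0; have [->//|ji] := eqVneq j i.
  exact: memT.
have := leq_trans (dim_square max_index) (leq_trans (dimvS sub) (dim_span _)).
rewrite size_image cardsCs setCK card_ord cards2 eq_sym nii0.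
have := max_card (mem [set i0; i]); rewrite cards2 eq_sym nii0 card_ord.
by case: (\dim {:E}) => [|[|m]] //; rewrite !subSS subn0 ltnn.
Qed.

(* [x] spans the last nonzero term of the derived series, so it lies in [V].
   Subtracting multiples of [x] from the complement of [V] spanned by the rest of
   [B'], one gets a complement whose elements have supports, with respect to [B],
   disjoint from those of the elements of [V]. *)
Lemma span_of_transfer (B' : n.-tuple E) (T : {set 'I_n}) (x : E) :
    natural_basis mul B' -> x != 0 -> mul x x = 0 -> x \in span_of B' T ->
  exists S, span_of B' T = span_of B S.
Proof.
move=> natB' xn0 xx0 xV; set V := span_of B' T in xV *.
have bB' := proj1 natB'.
pose C := span_of B' (~: T).
have VC u w : u \in V -> w \in C -> mul u w = 0.
  move=> uV /(mem_span_of natB') w0.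
  apply/eqP; rewrite -memv0; move: uV; rewrite /V => /(mem_span_of natB') u0.
  rewrite (natural_mulE _ _ natB') memv0 big1 // => i _.
  have [iT|niT] := boolP (i \in T); last by rewrite u0 // mul0r scale0r.
  by rewrite w0 ?mulr0 ?scale0r // inE negbK.
have split_e z : exists v w, [/\ v \in V, z = v + w &
    forall u, u \in V -> forall i : 'I_n, c i u * c i w = 0].
  have zVC : z \in (V + C)%VS.
    rewrite (coordn_sum bB' z) memv_suml // => i _; rewrite rpredZ //.
    have [iT|niT] := boolP (i \in T).
      by apply: (subvP (addvSl _ _)); rewrite (nth_span_of natB').
    by apply: (subvP (addvSr _ _)); rewrite (nth_span_of natB') inE.
  case/memv_addP: zVC => v vV [w wC def_z].
  have [a aP] := annihilating_pair xn0 xx0 (VC x w xV wC).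
  exists (v + a *: x), (w - a *: x); split; first by rewrite rpredD ?rpredZ.
    by rewrite addrACA subrr addr0.
  move=> u uV i; have [m mP] := annihilating_pair xn0 xx0 (VC u w uV wC).
  rewrite coordnB coordnZ mulrBr mP.
  (* Where [x] has coordinate 0, so does the product of coordinates of [u] and [w]; elsewhere [w]
     agrees with [a *: x], and the corrected vector vanishes. *)
  have [->|xi] := eqVneq (c i x) 0; first by rewrite !mulr0 subrr.
  have wi : c i w = a * c i x by apply: (mulfI xi); rewrite aP; ring.
  by rewrite -mP wi subrr.
(* Off [i] the coordinates of [v] and [w] are opposite with product zero, hence zero. So either
   [w = 0] and [e i] is in [V], or [w] is nonzero at [i] and all of [V] vanishes there. *)
have e_or (i : 'I_n) : e i \in V \/ forall u, u \in V -> c i u = 0.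
  have [v [w [vV def_e w0]]] := split_e (e i).
  have vw (j : 'I_n) : j != i -> c j v = 0 /\ c j w = 0.
    move=> nji; have := congr1 (c j) def_e.
    rewrite coordnD (coordn_nth bB) // (_ : (j : nat) == i = false); last exact/negbTE.
    move/esym/eqP; rewrite addr_eq0 => /eqP vNw; have := w0 v vV j.
    rewrite vNw mulNr => /eqP; rewrite oppr_eq0 mulf_eq0 orbb => /eqP ->.
    by rewrite oppr0.
  have [wi0|wi] := eqVneq (c i w) 0; [left|right].
    suff w_0 : w = 0 by rewrite def_e w_0 addr0.
    rewrite (coordn_sum bB w) big1 // => j _.
    have [->|/vw[_ ->]] := eqVneq j i; last by rewrite scale0r.
    by rewrite wi0 scale0r.
  move=> u uV; apply/eqP; have /eqP := w0 u uV i.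
  by rewrite mulf_eq0 (negPf wi) orbF.
exists [set i : 'I_n | e i \in V]; apply/eqP; rewrite eqEsubv; apply/andP; split.
  apply/subvP => u uV; apply/(mem_span_of natB) => i; rewrite inE => niV.
  by case: (e_or i) => [iV|]; [rewrite iV in niV | apply].
by apply/(span_of_subP natB) => i; rewrite inE.
Qed.

(** The natural basis in [basic_ideal] may change from one term to the next; [span_of_transfer],
    applied to a nonzero [x] of [D n], whose square is in [D n.+1 = 0], replaces it by the fixed
    [B]. *)
Lemma basic_idealP k : (0 < k <= n.+1)%N ->
  basic_ideal mul (D k) <-> spanned mul B k.
Proof.
move=> kn; have [k_gt0 lek] := andP kn; split=> [[B' [natB' [_ [T defD]]]]|/spannedP[S defD]].
  move: lek; rewrite leq_eqVlt => /predU1P[->|]; first exact: spanned_last.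
  rewrite ltnS => lekn.
  have n_gt0 : (0 < n)%N := leq_trans k_gt0 lekn.
  have Dn0 : D n != 0%VS by rewrite -dimv_eq0 dim_derived ?subSnn // n_gt0 leqnSn.
  pose x := vpick (D n); have xDn : x \in D n := memv_pick _.
  have xn0 : x != 0 by rewrite vpick0.
  have xx0 : mul x x = 0.
    by apply/eqP; rewrite -memv0 -(derived_last max_index) derived_mul.
  apply/spannedP; rewrite defD; apply: (span_of_transfer natB' xn0 xx0).
  by rewrite -defD; apply: (subvP (derived_le mul k_gt0 lekn)).
have sqD (i : 'I_n) : i \in S -> mul (e i) (e i) \in D k.
  by move=> iS; apply: derived_subalgebra; rewrite // defD (nth_span_of natB).
exists B; split=> //; split; last by exists S.
move=> x y yD; rewrite defD in yD; have yx := span_of_mul natB x sqD yD.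
by rewrite (natural_mulC x y natB).
Qed.

Lemma no_two_nonbasicP : no_two_consecutive_nonbasic mul <->
  (forall k, (0 < k <= n)%N -> spanned mul B k || spanned mul B k.+1).
Proof.
split=> [no2 k kn|sp [k [kn nb1 nb2]]].
  apply/norP => -[/negP ns1 /negP ns2]; apply: no2; exists k.
  split=> // /(basic_idealP _); [move/(_ ltac:(lia)) | move/(_ ltac:(lia))] => //.
by case/orP: (sp k kn) => s; [apply: nb1 | apply: nb2]; apply/basic_idealP => //; lia.
Qed.

End BasicIdeals.

(** * Construction of a normal form *)

Import passmx.

Section NormalFormExistence.

Variables (K : fieldType) (E : vectType K) (mul : {bilinear E -> E -> E}).
Implicit Types (s : seq E) (x y : E).

(* Vectors are listed from the bottom of the derived series upwards. *)
Inductive normal_seq : seq E -> Prop :=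
  | NormalNil : normal_seq [::]
  | NormalOne s x of normal_seq s & mul x x \in <<s>>%VS : normal_seq (rcons s x)
  | NormalTwo s x y of normal_seq s & mul x x - (x + y) \in <<s>>%VS
      & mul y y + (x + y) \in <<s>>%VS : normal_seq (rcons (rcons s x) y).

Definition pair_in_seq s k : Prop := [/\ (k.+1 < size s)%N,
  mul s`_k s`_k - (s`_k + s`_k.+1) \in <<take k s>>%VS
  & mul s`_k.+1 s`_k.+1 + (s`_k + s`_k.+1) \in <<take k s>>%VS].

Lemma normal_seq_nth s i : normal_seq s -> (i < size s)%N ->
  [\/ mul s`_i s`_i \in <<take i s>>%VS, pair_in_seq s i
    | exists2 k, i = k.+1 & pair_in_seq s k].
Proof.
have pair_cat s' t k : pair_in_seq s' k -> pair_in_seq (s' ++ t) k.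
  case=> ltk m1 m2; rewrite /pair_in_seq size_cat !nth_cat ltk (ltnW ltk).
  by rewrite takel_cat ?(ltnW (ltnW ltk)) // ltn_addr.
have ext s' t j : [\/ mul s'`_j s'`_j \in <<take j s'>>%VS, pair_in_seq s' j
      | exists2 k, j = k.+1 & pair_in_seq s' k] -> (j < size s')%N ->
    [\/ mul (s' ++ t)`_j (s' ++ t)`_j \in <<take j (s' ++ t)>>%VS,
       pair_in_seq (s' ++ t) j
     | exists2 k, j = k.+1 & pair_in_seq (s' ++ t) k].
  move=> Pj ltj; rewrite nth_cat ltj takel_cat ?(ltnW ltj) //.
  case: Pj => [m|m|[k ek m]]; [exact: Or31 | apply: Or32 | apply: Or33].
    exact: pair_cat.
  by exists k => //; apply: pair_cat.
move=> nf_s; elim: nf_s i => // {}s.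
  move=> x _ IHs xx i; rewrite size_rcons ltnS leq_eqVlt => /predU1P[->|ltis].
    by apply: Or31; rewrite nth_rcons ltnn eqxx -cats1 take_size_cat.
  by rewrite -cats1; apply: ext => //; apply: IHs.
move=> x y _ IHs xx yy i; rewrite !size_rcons => lti.
have Ps : pair_in_seq (s ++ [:: x; y]) (size s).
  rewrite /pair_in_seq size_cat /= addn2 ltnSn !nth_cat ltnn subnn.
  by rewrite ltnNge leqnSn /= subSnn /= take_size_cat.
rewrite -!cats1 -catA /=; have [ltis|leis] := ltnP i (size s).
  by apply: ext => //; apply: IHs.
have [->|->] : i = size s \/ i = (size s).+1 by lia.
  exact: Or32.
by apply: Or33; exists (size s).
Qed.

Lemma normal_seq_triangular n (X : n.-tuple E) : natural_basis mul X ->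
  normal_seq X -> triangular_entries (structure_matrix mul X).
Proof.
move=> natX nfX; have XB := proj1 natX.
have pairL k (x y : 'I_n) : pair_in_seq X k -> x = k :> nat -> y = k.+1 :> nat ->
    pair_at (structure_matrix mul X) x y /\
    forall j, (k.+1 < j)%N -> coordn X j (mul X`_k X`_k) = 0 /\
                              coordn X j (mul X`_k.+1 X`_k.+1) = 0.
  case; rewrite size_tuple => ltk m1 m2 xk yk; have ltk' := ltnW ltk.
  have c1 j : (k <= j)%N -> coordn X j (mul X`_k X`_k) = (j == k)%:R + (j == k.+1)%:R.
    move=> lekj; move/(mem_flag XB)/(_ j lekj)/eqP: m1.
    by rewrite coordnB coordnD !(coordn_nth XB) // subr_eq0 => /eqP.
  have c2 j : (k <= j)%N -> coordn X j (mul X`_k.+1 X`_k.+1) = - ((j == k)%:R + (j == k.+1)%:R).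
    move=> lekj; move/(mem_flag XB)/(_ j lekj)/eqP: m2.
    by rewrite !coordnD !(coordn_nth XB) // addr_eq0 => /eqP.
  split; last first.
    move=> j ltj; rewrite c1 ?c2 ?(ltnW (ltnW ltj)) // !gtn_eqF ?(ltnW ltj) //.
    by rewrite addr0 oppr0.
  rewrite /pair_at !structure_matrixE xk yk !c1 ?c2 //.
  by rewrite !eqxx ltn_eqF // gtn_eqF // addr0 add0r.
move=> i j leij; rewrite structure_matrixE => nz.
have := normal_seq_nth (i := i) nfX; rewrite size_tuple ltn_ord => /(_ isT).
case=> [m|m|[k i_k m]].
- by case/eqP: nz; move/(mem_flag XB): m; apply.
- left; have [lt_i _ _] := m; rewrite size_tuple in lt_i.
  have [pk c0] := pairL i i (Ordinal lt_i) m erefl erefl.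
  exists (Ordinal lt_i); split=> //.
  have [ltij|] := ltnP i.+1 j; first by case/eqP: nz; have [] := c0 j ltij.
  move=> leji; have [e|e] : j = i :> nat \/ j = i.+1 :> nat by lia.
    by left; apply: val_inj.
  by right; apply: val_inj.
- right; have ltk : (k < n)%N by rewrite -ltnS -i_k ltnS ltnW.
  have [pk c0] := pairL k (Ordinal ltk) i m erefl i_k.
  exists (Ordinal ltk); split=> //; apply: val_inj => /=.
  apply/eqP; rewrite eqn_leq leij andbT leqNgt; apply: contra nz.
  by rewrite i_k => ltj; have [_ ->] := c0 j ltj.
Qed.

Lemma rank_structure_matrix (X : (\dim {:E}).-tuple E) : natural_basis mul X ->
  \rank (structure_matrix mul X) = \dim (mulv mul {:E} {:E}).
Proof.
move=> natX; have XB := proj1 natX; set A := structure_matrix mul X.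
have rowA i : row i A = rVof X (mul X`_i X`_i).
  by apply/rowP => j; rewrite !mxE !(tnth_nth 0).
set V := mulv _ _ _; apply/eqP; rewrite eqn_leq; apply/andP; split.
  have sub : (A <= \matrix_(i < \dim V) rVof X (vbasis V)`_i)%MS.
    apply/row_subP => i; rewrite rowA.
    have qV : mul X`_i X`_i \in V by rewrite mem_mulv ?memvf.
    rewrite {1}(coord_vbasis qV) linear_sum; apply: summx_sub => j _.
    rewrite linearZ; apply: scalemx_sub.
    by apply: (eq_row_sub j); rewrite rowK.
  exact: leq_trans (mxrankS sub) (rank_leq_row _).
pose Y := [seq vecof X (row i (row_base A)) | i : 'I_(\rank A)].
have sub : (V <= <<Y>>)%VS.
  apply/mulv_subP => x y _ _; rewrite (natural_mulE _ _ natX) memv_suml // => i _.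
  rewrite rpredZ // -[mul _ _](rVofK XB) -rowA.
  have /submxP[w ->] : (row i A <= row_base A)%MS by rewrite eq_row_base row_sub.
  rewrite mulmx_sum_row linear_sum memv_suml // => j _.
  rewrite linearZ rpredZ //; apply: memv_span; exact: image_f.
by apply: leq_trans (dimvS sub) _; apply: leq_trans (dim_span _) _; rewrite size_image card_ord.
Qed.

Hypothesis max_index : max_solvability_index mul.
Local Notation n := (\dim {:E}).
Local Notation D := (derived mul).
Variable B : n.-tuple E.
Hypothesis natB : natural_basis mul B.
Local Notation e i := (B`_i).
Local Notation spanned := (spanned mul B).
Hypothesis spanned_or : forall k, (0 < k <= n)%N -> spanned k || spanned k.+1.

Definition orthogonal_seq s : Prop :=
  forall i j, (i < j < size s)%N -> mul s`_i s`_j = 0.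

Lemma orthogonal_rcons s x : orthogonal_seq s ->
  (forall y, y \in <<s>>%VS -> mul y x = 0) -> orthogonal_seq (rcons s x).
Proof.
move=> orth sx i j; rewrite size_rcons ltnS => /andP[ltij].
rewrite leq_eqVlt => /orP[/eqP ej|ltjs].
  rewrite ej in ltij *; rewrite !nth_rcons ltij ltnn eqxx sx //.
  by rewrite memv_span // mem_nth.
by rewrite !nth_rcons ltjs (ltn_trans ltij ltjs) orth // ltij.
Qed.

Lemma span_rcons s x : (<<rcons s x>> = <<s>> + <[x]>)%VS.
Proof. by rewrite -cats1 span_cat span_seq1. Qed.

Lemma normal_seq_derived m k : (k + m)%N = n.+1 -> (0 < k)%N -> spanned k ->
  exists s, [/\ normal_seq s, orthogonal_seq s, <<s>>%VS = D k & size s = m].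
Proof.
have mulC x y : mul x y = mul y x := natural_mulC x y natB.
have [m'] := ubnP m; elim: m' m k => // m' IHm [|m] k ltm km k_gt0 sp.
  exists [::]; split=> //; first exact: NormalNil.
    by move=> i j; rewrite ltn0 andbF.
  by rewrite span_nil -(addn0 k) km derived_last.
have lek : (k <= n)%N by lia.
have kn : (0 < k <= n)%N by rewrite k_gt0.
have [S defD] := spannedP _ _ _ sp.
have eD (i : 'I_n) : i \in S -> e i \in D k by rewrite defD (nth_span_of natB).
have sqD1 x : x \in D k -> mul x x \in D k.+1 by move=> xD; apply: derived_mul.
have [sp1|nsp1] := boolP (spanned k.+1).
  have [S1 defD1] := spannedP _ _ _ sp1.
  have [s [nf_s orth_s span_s size_s]] := IHm m k.+1 ltm ltac:(lia) isT sp1.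
  have [i iS niD] : exists2 i : 'I_n, i \in S & e i \notin D k.+1.
    apply/exists_inP; apply: contraT; rewrite negb_exists_in => /forall_inP eD1.
    case/negP: (derived_strict max_index kn); rewrite {1}defD.
    by apply/(span_of_subP natB) => i /eD1; rewrite negbK.
  have niS1 : i \notin S1 by rewrite defD1 (nth_span_of natB) in niD.
  exists (rcons s (e i)); split.
  - by apply: NormalOne => //; rewrite span_s sqD1 // eD.
  - apply: orthogonal_rcons => // y; rewrite span_s defD1 mulC => yS.
    exact: (span_of_orth natB) yS niS1.
  - by rewrite span_rcons span_s derived_add ?eD.
  - by rewrite size_rcons size_s.
have kn1 : (0 < k.+1 <= n)%N by apply: (nspanned_lt max_index natB) nsp1; rewrite ltnS.
have sp2 : spanned k.+2 by have := spanned_or kn1; rewrite (negPf nsp1).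
have [S2 defD2] := spannedP _ _ _ sp2.
have [s [l [a [sS lS nsl an0 defD1]]]] := derived_support max_index natB kn defD nsp1.
have [nsD nlD] := derived_pair_notin max_index natB kn defD an0 defD1.
set O := span_of B _ in defD1; set g := e s + a *: e l in defD1.
have def_g : e s + a *: e l = g by []; clearbody g.
have OD1 : (O <= D k.+1)%VS by rewrite defD1 addvSl.
have D21 : (D k.+2 <= D k.+1)%VS by apply: derived_sub.
have D10 : (D k.+1 <= D k)%VS by apply: derived_sub.
(* The vectors of [B] spanning [D k.+2] lie in [D k.+1], so [e s] and [e l] are not among them; the
   dimensions then agree. *)
have defO : O = D k.+2.
  have lek1 : (k.+1 <= n)%N by case/andP: kn1.
  apply/eqP; rewrite eq_sym eqEdim; apply/andP; split.
    rewrite defD2; apply/(span_of_subP natB) => i iS2.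
    have iD2 : e i \in D k.+2 by rewrite defD2 (nth_span_of natB).
    have iD1 := subvP D21 _ iD2; rewrite (nth_span_of natB) !inE.
    have iS : i \in S by rewrite -(nth_span_of natB) -defD (subvP D10).
    rewrite iS andbT; apply/andP; split.
      by apply: contraNneq nlD => <-.
    by apply: contraNneq nsD => <-.
  have ODn : O != D k.+1.
    by apply: contra nsp1 => /eqP defO; apply/spannedP; exists (S :\ s :\ l).
  have := eqEdim O (D k.+1); rewrite OD1 (negPf ODn) /= !(dim_derived max_index) //.
  by move/esym/negbT; rewrite -ltnNge !subSS -(subnSK lek1).
case: m km ltm => [|m] km ltm.
  by have [_] := andP kn1; rewrite -ltnS -km addn1 ltnn.
have km2 : (k.+2 + m)%N = n.+1 by rewrite -km !addSnnS.
have [t [nf_t orth_t span_t size_t]] := IHm m k.+2 (ltnW ltm) km2 isT sp2.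
have esl : mul (e s) (e l) = 0 by apply: (natural_orth natB).
have sO x : x \in O -> mul x (e s) = 0.
  by rewrite mulC; move/(span_of_orth natB); apply; rewrite !inE eqxx andbF.
have lO x : x \in O -> mul x (e l) = 0.
  by rewrite mulC; move/(span_of_orth natB); apply; rewrite !inE eqxx.
have gD1 : g \in D k.+1 by rewrite defD1 (subvP (addvSr _ _)) ?memv_line.
have ngO : g \notin O.
  apply: contra nsp1 => gO; apply/spannedP; exists (S :\ s :\ l).
  by rewrite defD1; apply/addv_idPl; rewrite -memvE.
have := sqD1 _ (eD s sS); rewrite defD1 => /memv_addP[os osO [_ /vlineP[b ->] ss]].
have := sqD1 _ (eD l lS); rewrite defD1 => /memv_addP[ol olO [_ /vlineP[b' ->] ll]].
(* Modulo [O] the squares of [e s] and [e l] are [b *: g] and [b' *: g], so this is the coefficient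
   of [g] in [g ^ 2], which lies in [D k.+2 = O]. *)
have bb' : b + a ^+ 2 * b' = 0.
  apply/eqP; apply: contraNT ngO => nz.
  have : mul g g \in O by rewrite defO derived_mul.
  rewrite -{1 2}def_g linearDl !linearDr /= !linearZl_LR !linearZr_LR /=.
  rewrite (mulC (e l) (e s)) esl !scaler0 addr0 add0r ss ll.
  rewrite !scalerDr !scalerA addrACA -scalerDl rpredDl; last by rewrite rpredD ?rpredZ.
  by rewrite -expr2 => h; rewrite -(scalerK nz g) rpredZ.
have bn0 : b != 0.
  apply: contraTneq (derived_strict max_index kn1) => b0; rewrite negbK.
  have b'0 : b' = 0.
    move/eqP: bb'; rewrite b0 add0r mulf_eq0 expf_eq0 (negPf an0) andbF /=.
    by move/eqP.
  rewrite -defO; apply: derived_sq_sub defD _ => // i iS.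
  have [->|nis] := eqVneq i s; first by rewrite ss b0 scale0r addr0.
  have [->|nil] := eqVneq i l; first by rewrite ll b'0 scale0r addr0.
  rewrite defO derived_mul //; apply: (subvP OD1);
    by rewrite (nth_span_of natB) !inE nil nis.
(* The ratio [a] makes [x + y] a multiple of [g]; the factor [b^-1] then normalises [x ^ 2] to
   [x + y] modulo [O], and [bb'] gives [- (x + y)] for [y ^ 2]. *)
pose x := b^-1 *: e s; pose y := (b^-1 * a) *: e l.
have xyE : x + y = b^-1 *: g by rewrite /x /y -def_g scalerDr scalerA.
have xx : mul x x - (x + y) \in O.
  rewrite xyE /x linearZl_LR linearZr_LR /= ss !scalerDr !scalerA divfK //.
  by rewrite addrK !rpredZ.
have yy : mul y y + (x + y) \in O.
  rewrite xyE /y linearZl_LR linearZr_LR /= ll !scalerDr !scalerA -addrA -scalerDl.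
  have -> : b^-1 * a * (b^-1 * a) * b' + b^-1 = 0.
    transitivity (b^-1 * b^-1 * (b + a ^+ 2 * b')); first by field.
    by rewrite bb' mulr0.
  by rewrite scale0r addr0 !rpredZ.
exists (rcons (rcons t x) y); split.
- by apply: NormalTwo; rewrite ?span_t -?defO.
- apply: orthogonal_rcons; last first.
    move=> z; rewrite span_rcons span_t -defO => /memv_addP[w wO [_ /vlineP[d ->] ->]].
    rewrite linearDl linearZl_LR /= /y linearZr_LR /= lO // scaler0 add0r.
    by rewrite /x linearZl_LR linearZr_LR /= esl !scaler0.
  apply: orthogonal_rcons => // z; rewrite span_t -defO => zO.
  by rewrite /x linearZr_LR /= sO // scaler0.
- rewrite !span_rcons span_t -defO; apply/eqP; rewrite eqEsubv.
  rewrite !subv_add -!memvE (subv_trans OD1 D10) !rpredZ ?eD //= defD.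
  apply/(span_of_subP natB) => i iS; have [->|nis] := eqVneq i s.
    have -> : e s = b^-1^-1 *: x by rewrite /x scalerK ?invr_neq0.
    rewrite rpredZ //; apply: (subvP (addvSl _ _)); apply: (subvP (addvSr _ _)).
    exact: memv_line.
  have [->|nil] := eqVneq i l.
    have -> : e l = (b^-1 * a)^-1 *: y by rewrite /y scalerK // mulf_neq0 ?invr_neq0.
    by rewrite rpredZ //; apply: (subvP (addvSr _ _)); apply: memv_line.
  do 2 apply: (subvP (addvSl _ _)).
  by rewrite (nth_span_of natB) !inE nil nis.
- by rewrite !size_rcons size_t.
Qed.

End NormalFormExistence.
Section Existence.

Variables (K : fieldType) (E : vectType K) (mul : {bilinear E -> E -> E}).
Hypotheses (K2 : 2%:R != 0 :> K) (max_index : max_solvability_index mul).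
Local Notation n := (\dim {:E}).

Lemma normal_form_exists (B : n.-tuple E) : natural_basis mul B ->
    (forall k, (0 < k <= n)%N -> spanned mul B k || spanned mul B k.+1) ->
  exists B' : n.-tuple E, normal_form mul B'.
Proof.
move=> natB sp_or.
have [s [nf_s orth_s span_s size_s]] :=
  normal_seq_derived max_index natB sp_or (add1n n) isT (spanned1 natB).
pose X := Tuple (introT eqP size_s); have natX : natural_basis mul X.
  split; first by rewrite basisEdim span_s derived1 subvv size_tuple leqnn.
  move=> i j; rewrite !(tnth_nth 0) neq_ltn => /orP[ltij|ltji].
    by rewrite orth_s // ltij size_s ltn_ord.
  by rewrite (natural_mulC _ _ natB) orth_s // ltji size_s ltn_ord.
exists X; split=> //; apply: entries_normal_form => //.
  exact: normal_seq_triangular.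
rewrite rank_structure_matrix //; apply/eqP; rewrite eqn_leq (dim_square max_index) andbT.
case: (posnP n) => [n0|n_gt0]; first by rewrite (leq_trans (dimvS (subvf _))) // n0.
by rewrite -[mulv _ _ _]/(derived mul 2) (dim_derived max_index) ?subSS ?subn1 // ltnS.
Qed.

End Existence.

Theorem corollary6p11 (K : fieldType) (E : vectType K)
    (mul : {bilinear E -> E -> E}%R) :
  2%N \notin [pchar K]%R ->
  evolution_algebra mul -> solvable mul -> max_solvability_index mul ->
  (modular mul <->
     no_two_consecutive_nonbasic mul /\
     (exists B : (\dim {:E}%VS).-tuple E,
        normal_form mul B /\ no_obstruction mul B))
  /\
  (modular mul <->
     no_two_consecutive_nonbasic mul /\
     (forall B : (\dim {:E}%VS).-tuple E,
        normal_form mul B -> no_obstruction mul B)).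
Proof.
move=> char2 [B natB] _ max_index.
have K2 : 2%:R != 0 :> K by apply: contraNneq char2 => K2; rewrite inE K2 eqxx.
have dim_sq := dim_square max_index.
have to_modular (C : (\dim {:E}).-tuple E) : normal_form mul C -> no_obstruction mul C -> modular mul.
  case=> natC nfC.
  exact: (no_obstruction_modular K2 natC (normal_form_entries nfC) dim_sq).
have of_modular (C : (\dim {:E}).-tuple E) : modular mul -> normal_form mul C -> no_obstruction mul C.
  move=> modE [natC nfC].
  exact: (modular_no_obstruction K2 natC (normal_form_entries nfC) dim_sq modE).
have no2_modular : modular mul -> no_two_consecutive_nonbasic mul.
  by move=> modE; apply/(no_two_nonbasicP max_index natB)/modular_spanned.
have ex_nf : no_two_consecutive_nonbasic mul ->
    exists C : (\dim {:E}).-tuple E, normal_form mul C.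
  by move=> /(no_two_nonbasicP max_index natB); apply: normal_form_exists.
split; split.
- move=> modE; have no2 := no2_modular modE; split=> //.
  by have [C nfC] := ex_nf no2; exists C; split=> //; apply: of_modular.
- by case=> _ [C [nfC noC]]; apply: to_modular nfC noC.
- move=> modE; split; first exact: no2_modular.
  by move=> C; apply: of_modular.
- by case=> no2 noC; have [C nfC] := ex_nf no2; apply: (to_modular C) => //; apply: noC.
Qed.
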